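(* Let $(T,\mathcal A)$ be a standard Borel space, $\mathcal A$ being its Borel $\sigma$-field, and let $(\mathcal F_A)_{A\in\mathcal A}$ be a family of sub-$\sigma$-fields $\mathcal F_A\subset\mathcal F$ on a probability space $(\Omega,\mathcal F,P)$ such that (i) for all $A,B\in\mathcal A$ with $A\cap B=\emptyset$, the $\sigma$-fields $\mathcal F_A$ and $\mathcal F_B$ are independent, and $\mathcal F_{A\cup B}$ is generated by $\mathcal F_A\cup\mathcal F_B$; (ii) if $A_1\subset A_2\subset\cdots$ belong to $\mathcal A$ and $A=\bigcup_n A_n$, then $\mathcal F_A$ is generated by $\bigcup_n\mathcal F_{A_n}$. Then $(\mathcal F_A)_{A\in\mathcal A}$ is linearizable: for every $A\in\mathcal A$, the $\sigma$-field $\mathcal F_A$ is generated by the random variables $X_A$, where $(X_B)_{B\in\mathcal A}$ runs over all decomposable processes of the family $(\mathcal F_B)_{B\in\mathcal A}$. In particular, if $\mathcal F_T$ is nondegenerate (contains an event of probability strictly between $0$ and $1$), then there exists a nontrivial decomposable process, i.e. one for which not all $X_A$ are almost surely constant.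
   Context: All sub-$\sigma$-fields are understood modulo null sets: every sub-$\sigma$-field considered contains all $P$-null sets of $\mathcal F$, and the $\sigma$-field generated by a collection of events, $\sigma$-fields or random variables is understood to include these null sets. Random variables are real-valued and treated as equivalence classes modulo almost sure equality. A decomposable process of the family $(\mathcal F_A)_{A\in\mathcal A}$ is a family $(X_A)_{A\in\mathcal A}$ of random variables such that: $X_A$ is $\mathcal F_A$-measurable for every $A\in\mathcal A$; $X_{A\cup B}=X_A+X_B$ (almost surely) whenever $A,B\in\mathcal A$, $A\cap B=\emptyset$; and if $A_1\subset A_2\subset\cdots$ belong to $\mathcal A$ and $A=\bigcup_n A_n$, then $X_{A_n}\to X_A$ in probability (equivalently, almost surely, since $X_{A_n}$ are partial sums of independent random variables). *)

(* Defs.v *)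
From HB Require Import structures.
From mathcomp Require Import all_boot all_order all_algebra.
From mathcomp Require Import all_classical all_reals all_analysis.
Set Implicit Arguments.
Unset Strict Implicit.
Unset Printing Implicit Defensive.
Import Order.TTheory GRing.Theory Num.Theory.
Import numFieldNormedType.Exports.
Local Open Scope classical_set_scope.
Local Open Scope ring_scope.

Definition polish_space (R : realType) (M : metricType R) : Prop :=
  (forall u : nat -> M, cauchy (u @ \oo) -> exists l : M, u @ \oo --> l) /\
  (exists2 D : set M, countable D & dense D).

(* [T] is a bare type rather than a [measurableType] because the latter is
   pointed, which would exclude the empty standard Borel space. *)
Definition standard_borel (R : realType) (T : Type) (calA : set_system T) :
    Prop :=
  exists (M : metricType R) (f : T -> M),
    [/\ polish_space M, bijective f
      & calA = preimage_set_system setT f <<s (@open M) >>].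

Section factorizations.
Context (d : measure_display) (Omega : measurableType d) (R : realType)
  (P : probability Omega R).

Definition null_sets : set_system Omega :=
  [set N | measurable N /\ P N = 0%E].

Definition sub_sigma_field (G : set_system Omega) : Prop :=
  [/\ sigma_algebra setT G, G `<=` measurable & null_sets `<=` G].

Definition generated (G : set_system Omega) : set_system Omega :=
  <<s G `|` null_sets >>.

Definition independent (G H : set_system Omega) : Prop :=
  forall E E', G E -> H E' -> P (E `&` E') = (P E * P E')%E.

Definition cvg_in_probability (X_ : nat -> {RV P >-> R}) (X : {RV P >-> R}) :
    Prop :=
  forall e : R, 0 < e ->
    P [set w | e <= `|X_ n w - X w|] @[n --> \oo] --> 0%E.

Context (T : Type) (calA : set_system T) (F : set T -> set_system Omega).

(* The values of [X] and [F] outside [calA] are irrelevant. *)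
Definition decomposable_process (X : set T -> {RV P >-> R}) : Prop :=
  [/\ forall A, calA A -> g_sigma_algebra_preimage (X A) `<=` F A,
      forall A B, calA A -> calA B -> A `&` B = set0 ->
        {ae P, forall w, X (A `|` B) w = X A w + X B w}
    & forall A_ : nat -> set T, (forall n, calA (A_ n)) ->
        (forall n, A_ n `<=` A_ n.+1) ->
        cvg_in_probability (fun n => X (A_ n)) (X (\bigcup_n A_ n))].

Definition linearizable : Prop :=
  forall A, calA A ->
    F A = generated
      (\bigcup_(X in decomposable_process) g_sigma_algebra_preimage (X A)).

Definition nontrivial_process (X : set T -> {RV P >-> R}) : Prop :=
  ~ (forall A, calA A -> exists c : R, {ae P, forall w, X A w = c}).

Definition nondegenerate_field (G : set_system Omega) : Prop :=
  exists2 E, G E & (0 < P E < 1)%E.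

End factorizations.

(* Main.v *)
Require Import Defs.
From HB Require Import structures.
From mathcomp Require Import all_boot all_order all_algebra.
From mathcomp Require Import all_classical all_reals all_analysis.
From mathcomp Require Import measurable_realfun ring lra.
Set Implicit Arguments.
Unset Strict Implicit.
Unset Printing Implicit Defensive.
Import Order.TTheory GRing.Theory Num.Theory.
Import numFieldNormedType.Exports.
Local Open Scope classical_set_scope.
Local Open Scope ring_scope.

(** For f in L2(F_T), the projections Q_A = E[. | F_A] commute and satisfy
Q_A Q_B = Q_(A n B), so every finite measurable partition of T splits f into
orthogonal pieces indexed by the set J of cells which are "visited": the finite
shadows of a random spectral set.  Continuity of A |-> Q_A forces the spectral
sets to be finite.  Indeed, if infinitely many points were visited inside D with
mass x, colour the cells of a fine partition of D at random with r colours: up to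
a small error all colours are hit, while at most one colour class can have an
(almost) finitely visited complement, so one may remove from D a set that is hit
with mass almost x and keep infinite spectrum of mass almost x in the rest.
Iterating gives disjoint sets E_n hit with mass at least x / 2, although the sets
U_(k >= n) E_k decrease to the empty set.

Hence there is a partition c such that, up to mass e, no refinement separates two
visited points of one cell of c.  The projection of f to "at most one visited
point in each cell of c" is a limit along refinements; on products of functions
u_k of the cells it acts factorwise, and in the limit turns u_k into E[u_k] plus
an element psi_k of the first chaos.  The process A |-> Q_A psi_k is decomposable,
so f is approximated by functions of decomposable processes. *)

(** * Hilbert spaces *)

(** No random set is ever built: every statement concerns a finite partition, and limits are taken
    in L2 along the directed family of all partitions, where the relevant projections decrease.

    Many colours are used because both halves of a split must keep nearly all the mass. Among r + 1
    colour classes at most one has a small complement, so averaging leaves a fraction r / (r + 1) of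
    the mass. Two colours would lose half of it at each step, whereas for r large the losses of
    infinitely many steps stay below x / 2.

    The approximation is run by duality. Let f be orthogonal to all functions of decomposable
    processes. The projection to at most one visited point per cell is symmetric, so it can be moved
    from f onto a product of indicators, which it turns, in the limit, into a function of
    decomposable processes. Hence the limit projection of f is orthogonal to every such product and
    vanishes, although it is close to f. *)

Section hilbert_def.
Context (R : realType) (H : lmodType R) (dot : H -> H -> R).

(** Distances stay squared throughout: the triangle inequality becomes [sqn_addB], at the price of a
    factor 2. *)
Definition l2cauchy (x : nat -> H) : Prop :=
  forall e : R, 0 < e -> exists N, forall n m, (N <= n)%N -> (N <= m)%N ->
    dot (x n - x m) (x n - x m) <= e.

Definition l2cvg (x : nat -> H) (y : H) : Prop :=
  forall e : R, 0 < e -> exists N, forall n, (N <= n)%N ->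
    dot (x n - y) (x n - y) <= e.

Record inner_product : Prop := InnerProduct {
  dotC : forall x y, dot x y = dot y x;
  dotDl : forall x y z, dot (x + y) z = dot x z + dot y z;
  dotZl : forall a x y, dot (a *: x) y = a * dot x y;
  dot_ge0 : forall x, 0 <= dot x x;
  dot_eq0 : forall x, dot x x = 0 -> x = 0 }.

Record hilbert : Prop := Hilbert {
  hilbert_inner :> inner_product;
  hilbert_complete : forall x, l2cauchy x -> exists y, l2cvg x y }.

End hilbert_def.

Lemma harmonic_small (R : realType) (e : R) :
  0 < e -> exists N, forall n, (N <= n)%N -> n.+1%:R^-1 <= e.
Proof.
move=> e0; exists (Num.truncn e^-1) => n Nn.
rewrite -[leRHS]invrK lef_pV2 ?posrE ?invr_gt0//.
by apply/ltW/(lt_le_trans (truncnS_gt _)); rewrite ler_nat.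
Qed.

Lemma geometric_small (R : realType) (r : R) (a e : R) : 0 <= r -> r < 1 -> 0 < e ->
  exists M, a * r ^+ M <= e.
Proof.
move=> r0 r1 e0.
have h : (a * r ^+ n @[n --> \oo] --> a * 0)%classic.
  by apply: cvgMr; apply: cvg_expr; rewrite ger0_norm.
rewrite mulr0 in h.
have /cvgrPdist_le/(_ _ e0)[M _ hM] := h.
exists M; have := hM M (leqnn M); rewrite /= sub0r normrN.
exact: le_trans (ler_norm _).
Qed.

Section inner_product.
Context (R : realType) (H : lmodType R) (dot : H -> H -> R).
Hypothesis hH : inner_product dot.
Local Notation "<[ x , y ]>" := (dot x y) (format "<[ x ,  y ]>").
Local Notation sqn x := (dot x x).

Lemma dotDr x y z : <[z, x + y]> = <[z, x]> + <[z, y]>.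
Proof. by rewrite !(dotC hH z) (dotDl hH). Qed.

Lemma dotZr a x y : <[x, a *: y]> = a * <[x, y]>.
Proof. by rewrite !(dotC hH x) (dotZl hH). Qed.

Lemma dot0l x : <[0, x]> = 0.
Proof. by rewrite -(scale0r 0) (dotZl hH) mul0r. Qed.

Lemma dot0r x : <[x, 0]> = 0.
Proof. by rewrite (dotC hH) dot0l. Qed.

Lemma dotNl x y : <[- x, y]> = - <[x, y]>.
Proof. by rewrite -scaleN1r (dotZl hH) mulN1r. Qed.

Lemma dotNr x y : <[x, - y]> = - <[x, y]>.
Proof. by rewrite (dotC hH) dotNl (dotC hH). Qed.

Lemma dotBl x y z : <[x - y, z]> = <[x, z]> - <[y, z]>.
Proof. by rewrite (dotDl hH) dotNl. Qed.

Lemma dotBr x y z : <[z, x - y]> = <[z, x]> - <[z, y]>.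
Proof. by rewrite dotDr dotNr. Qed.

Lemma dot_suml I (r : seq I) (Pr : pred I) (F : I -> H) y :
  <[\sum_(i <- r | Pr i) F i, y]> = \sum_(i <- r | Pr i) <[F i, y]>.
Proof.
elim/big_rec2: _ => [|i u v _ <-]; first by rewrite dot0l.
by rewrite (dotDl hH).
Qed.

Lemma dot_sumr I (r : seq I) (Pr : pred I) (F : I -> H) y :
  <[y, \sum_(i <- r | Pr i) F i]> = \sum_(i <- r | Pr i) <[y, F i]>.
Proof. by rewrite (dotC hH) dot_suml; apply: eq_bigr => i _; rewrite (dotC hH). Qed.

Lemma sqnB x y : sqn (x - y) = sqn x - 2 * <[x, y]> + sqn y.
Proof. by rewrite dotBl !dotBr (dotC hH y x); ring. Qed.

Lemma sqnBC x y : sqn (x - y) = sqn (y - x).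
Proof. by rewrite !sqnB (dotC hH x y); ring. Qed.

Lemma sqn_addB x y z : sqn (x - z) <= 2 * (sqn (x - y) + sqn (y - z)).
Proof.
have -> : x - z = (x - y) + (y - z) by rewrite addrA subrK.
move: (x - y) (y - z) => u v.
have := dot_ge0 hH (u - v); rewrite sqnB.
have -> : sqn (u + v) = sqn u + 2 * <[u, v]> + sqn v.
  by rewrite (dotDl hH) !dotDr (dotC hH v u); ring.
lra.
Qed.

Lemma dot_ext x y : (forall z, <[x, z]> = <[y, z]>) -> x = y.
Proof.
move=> xy; apply/eqP; rewrite -subr_eq0; apply/eqP/(dot_eq0 hH).
by rewrite dotBl xy subrr.
Qed.

Lemma dot_CS x y : <[x, y]> ^+ 2 <= sqn x * sqn y.
Proof.
have [y0|y0] := eqVneq (sqn y) 0.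
  by rewrite (dot_eq0 hH y0) !dot0r mulr0 expr0n.
have yp : 0 < sqn y by rewrite lt_neqAle eq_sym y0 (dot_ge0 hH).
have := dot_ge0 hH (sqn y *: x - <[x, y]> *: y).
rewrite sqnB !(dotZl hH) !dotZr => h.
rewrite -(ler_pM2l yp) -subr_ge0; apply: le_trans h _.
by rewrite le_eqVlt; apply/orP; left; apply/eqP; ring.
Qed.

Lemma ler_sqr_small (c a : R) :
  0 <= a -> (forall e : R, 0 < e -> c ^+ 2 <= e * a) -> c = 0.
Proof.
move=> a0 h; apply/eqP; rewrite -sqrf_eq0 eq_le sqr_ge0 andbT leNgt.
apply/negP => c0; have a1 : 0 < a + 1 by lra.
have := h _ (divr_gt0 c0 a1); rewrite leNgt => /negP; apply.
by rewrite mulrAC ltr_pdivrMr// ltr_pM2l//; lra.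
Qed.

Lemma dot_closed y z :
  (forall e : R, 0 < e -> exists2 x, sqn (x - y) <= e & <[x, z]> = 0) ->
  <[y, z]> = 0.
Proof.
move=> h; apply: (@ler_sqr_small _ (sqn z)); first exact: (dot_ge0 hH).
move=> e /h[x xy xz]; have -> : <[y, z]> = <[y - x, z]> by rewrite dotBl xz subr0.
apply: le_trans (dot_CS _ _) _; rewrite sqnBC ler_wpM2r//.
exact: (dot_ge0 hH).
Qed.

Lemma l2cvg_dot0 (x : nat -> H) y z : l2cvg dot x y ->
  (forall e : R, 0 < e -> exists N, forall n, (N <= n)%N -> <[x n, z]> ^+ 2 <= e) ->
  <[y, z]> = 0.
Proof.
move=> xy xz; apply: (@ler_sqr_small _ (2 * (sqn z + 1))).
  by have := dot_ge0 hH z; lra.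
move=> e e0; have [N hN] := xy _ e0; have [M hM] := xz _ e0.
have /= h1 := hN _ (leq_maxl N M); have /= h2 := hM _ (leq_maxr N M).
have h3 := dot_CS (x (maxn N M) - y) z.
have h4 : sqn (x (maxn N M) - y) * sqn z <= e * sqn z.
  by rewrite ler_wpM2r// (dot_ge0 hH).
move: h3; rewrite dotBl => h3.
set u := <[x _, z]> in h2 h3; set v := <[y, z]> in h3 *.
(* The identity [2 u^2 + 2 (u - v)^2 - v^2 = (2 u - v)^2] bounds [v^2]. *)
have := sqr_ge0 (2 * u - v); nra.
Qed.

Section symmetric_operator.
Context (Q : H -> H).
Hypothesis Qsym : forall x y, <[Q x, y]> = <[x, Q y]>.

(** Linearity is a consequence of symmetry, since the inner product separates points; this is why
    [boolean_projections] records only symmetry. *)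
Lemma symD x y : Q (x + y) = Q x + Q y.
Proof. by apply: dot_ext => z; rewrite (dotDl hH) !Qsym (dotDl hH). Qed.

Lemma symZ a x : Q (a *: x) = a *: Q x.
Proof. by apply: dot_ext => z; rewrite (dotZl hH) !Qsym (dotZl hH). Qed.

Lemma sym0 : Q 0 = 0.
Proof. by have := symZ 0 0; rewrite !scale0r. Qed.

Lemma symB x y : Q (x - y) = Q x - Q y.
Proof. by rewrite symD -scaleN1r symZ scaleN1r. Qed.

Lemma sym_sum I (r : seq I) (Pr : pred I) (F : I -> H) :
  Q (\sum_(i <- r | Pr i) F i) = \sum_(i <- r | Pr i) Q (F i).
Proof. by rewrite (big_morph Q symD sym0). Qed.

Lemma sym_idem_sqn x : Q (Q x) = Q x -> sqn (Q x) = <[Q x, x]>.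
Proof. by move=> QQ; rewrite Qsym QQ (dotC hH). Qed.

Lemma sym_idem_sqnB x : Q (Q x) = Q x -> sqn (x - Q x) = sqn x - sqn (Q x).
Proof. by move=> QQ; rewrite sqnB (sym_idem_sqn QQ) (dotC hH x (Q x)); ring. Qed.

Lemma sym_idem_le x : Q (Q x) = Q x -> sqn (Q x) <= sqn x.
Proof. by move=> QQ; rewrite -subr_ge0 -sym_idem_sqnB// (dot_ge0 hH). Qed.

End symmetric_operator.

End inner_product.

Section hilbert.
Context (R : realType) (H : lmodType R) (dot : H -> H -> R).
Hypothesis hH : hilbert dot.
Local Notation "<[ x , y ]>" := (dot x y) (format "<[ x ,  y ]>").
Local Notation sqn x := (dot x x).

(* The hypothesis on [x] says that [x j] is the orthogonal projection of [x i]
   onto a smaller subspace whenever [j] is beyond [i]. *)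
Lemma decreasing_net_cvg (I : Type) (le : I -> I -> Prop) (x : I -> H) (i0 : I) :
  (forall i j, exists k, le i k /\ le j k) ->
  (forall i j, le i j -> <[x i, x j]> = sqn (x j)) ->
  exists y, forall e : R, 0 < e -> exists i, forall j, le i j -> sqn (x j - y) <= e.
Proof.
move=> dir hx; pose S : set R := fun r => exists i, r = sqn (x i).
have S0 : has_inf S.
  split; first by exists (sqn (x i0)), i0.
  by exists 0 => _ [i ->]; exact: (dot_ge0 hH).
have S_ge j : inf S <= sqn (x j) by apply: ge_inf; [exact: S0.2|exists j].
(* Along the net, [sqn (x i - x j) = sqn (x i) - sqn (x j)], so a nearly minimal norm controls the
   distance to all later vectors at once. *)
have near_inf (e : R) : 0 < e -> exists i, forall j, le i j -> sqn (x i - x j) <= e.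
  move=> e0; have [_ [i ->] h] := inf_adherent e0 S0.
  exists i => j /hx hij; rewrite (sqnB hH) hij.
  by have := S_ge j; lra.
have /choice[y_ hy] : forall n, exists y, exists2 i, y = x i &
    forall j, le i j -> sqn (y - x j) <= n.+1%:R^-1.
  move=> n; have [|i hi] := near_inf n.+1%:R^-1; first by rewrite invr_gt0 ltr0Sn.
  by exists (x i), i.
have [|y xy] := @hilbert_complete _ _ _ hH y_.
  move=> e e0; have e4 : 0 < e / 4 by lra.
  have [N hN] := harmonic_small e4.
  exists N => n m /hN hn /hN hm /=.
  have [i _ hi] := hy n; have [j _ hj] := hy m.
  have [k [ik jk]] := dir i j.
  apply: le_trans (sqn_addB hH _ (x k) _) _; rewrite (sqnBC hH (x k)).
  have := le_trans (hi _ ik) hn; have := le_trans (hj _ jk) hm; lra.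
exists y => e e0.
have e4 : 0 < e / 8 by lra.
have [N hN] := harmonic_small e4; have [M hM] := xy _ e4.
have /= h1 := hN _ (leq_maxl N M); have /= h2 := hM _ (leq_maxr N M).
have [i _ hi] := hy (maxn N M).
exists i => j /hi /le_trans /(_ h1) h3.
apply: le_trans (sqn_addB hH _ (y_ (maxn N M)) _) _.
rewrite (sqnBC hH (x j)); lra.
Qed.

(* For a near-minimiser [s] of the distance to [x] within [S], the vector
   [x - s] is nearly orthogonal to [S]; this gives both the Cauchy property and
   the orthogonality of the limit. *)
Lemma orthogonal_projection (S : H -> Prop) :
  S 0 -> (forall a x y, S x -> S y -> S (a *: x + y)) ->
  (forall x, (forall n, S (x n)) -> l2cauchy dot x -> exists2 y, S y & l2cvg dot x y) ->
  exists Q : H -> H, forall x, S (Q x) /\ forall s, S s -> <[x - Q x, s]> = 0.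
Proof.
move=> S0 Slin Scomplete.
suff /choice[Q hQ] : forall x, exists q, S q /\ forall s, S s -> <[x - q, s]> = 0.
  by exists Q.
move=> x.
pose D := [set sqn (x - s) | s in S].
have D0 : has_inf D.
  split; first by exists (sqn (x - 0)); exists 0.
  by exists 0 => _ [i _ <-]; exact: (dot_ge0 hH).
have D_ge s : S s -> inf D <= sqn (x - s).
  by move=> Ss; apply: ge_inf; [exact: D0.2|exists s].
have near_orth (e : R) : 0 < e ->
    exists2 s, S s & forall u, S u -> <[x - s, u]> ^+ 2 <= e * sqn u.
  move=> e0; have [_ [s Ss <-] h] := inf_adherent e0 D0.
  exists s => // u Su.
  (* Moving from [s] to [t *: u + s] lowers the squared distance by at most [e]; the optimal [t] is
     [<[x - s, u]> / sqn u]. *)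
  have quad t : 0 <= e - 2 * t * <[x - s, u]> + t ^+ 2 * sqn u.
    have := D_ge _ (Slin t _ _ Su Ss).
    rewrite opprD addrCA addrC (sqnB hH) !(dotZr hH) (dotZl hH) => h'.
    rewrite expr2; nra.
  have [u0|u0] := eqVneq (sqn u) 0.
    by rewrite (dot_eq0 hH u0) !(dot0r hH) mulr0 expr0n.
  have up : 0 < sqn u by rewrite lt_neqAle eq_sym u0 (dot_ge0 hH).
  have := mulr_ge0 (ltW up) (quad (<[x - s, u]> / sqn u)).
  move=> h1; rewrite -subr_ge0; move: h1; suff -> : sqn u * (e - 2 * (<[x - s, u]> / sqn u) *
    <[x - s, u]> + (<[x - s, u]> / sqn u) ^+ 2 * sqn u) =
    e * sqn u - <[x - s, u]> ^+ 2 by [].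
  by field.
have [s_ hs] : {s_ : nat -> H & forall n, S (s_ n) /\ forall u, S u ->
    <[x - s_ n, u]> ^+ 2 <= n.+1%:R^-1 * sqn u}.
  apply: (@choice _ _ (fun n s => S s /\ forall u, S u -> <[x - s, u]> ^+ 2 <= _)) => n.
  by have [|s] := near_orth n.+1%:R^-1; [rewrite invr_gt0 ltr0Sn|exists s].
have dist n m : sqn (s_ n - s_ m) <= 2 * (n.+1%:R^-1 + m.+1%:R^-1).
  have [Sn on] := hs n; have [Sm om] := hs m.
  pose u := s_ n - s_ m.
  have Su : S u by rewrite /u addrC -scaleN1r; exact: Slin.
  (* Both pairings are small relative to [u] itself: with [w = sqn u] this gives
     [w^2 <= 2 (p + q) w], and one factor [w] cancels. *)
  have uE : sqn u = <[x - s_ m, u]> - <[x - s_ n, u]>.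
    by rewrite -(dotBl hH); congr dot; rewrite opprB [RHS]addrC addrA subrK.
  have := on _ Su; have := om _ Su; rewrite -/u.
  move: uE (dot_ge0 hH u); move: (sqn u) <[x - s_ m, u]> <[x - s_ n, u]>.
  move=> w a b -> ab0; set p := m.+1%:R^-1; set q := n.+1%:R^-1 => ha hb.
  have [ab|ab] := eqVneq (a - b) 0.
    by rewrite ab mulr_ge0// addr_ge0// invr_ge0 ler0n.
  have abp : 0 < a - b by rewrite lt_neqAle eq_sym ab.
  rewrite -(ler_pM2l abp).
  have := sqr_ge0 (a + b); nra.
have [|y Sy xy] := Scomplete _ (fun n => (hs n).1).
  move=> e e0; have e4 : 0 < e / 4 by lra.
  have [N hN] := harmonic_small e4; exists N => n m /hN hn /hN hm.
  by apply: le_trans (dist _ _) _; move: n.+1%:R^-1 m.+1%:R^-1 hn hm => a b; lra.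
exists y; split=> // s Ss.
have cvgx : l2cvg dot (fun n => x - s_ n) (x - y).
  move=> e /xy[N hN]; exists N => n /hN.
  have -> : x - s_ n - (x - y) = y - s_ n by rewrite opprB addrC addrA subrK.
  by rewrite (sqnBC hH).
apply: (l2cvg_dot0 hH cvgx) => e e0.
have s1 : 0 < sqn s + 1 by have := dot_ge0 hH s; lra.
have [N hN] := harmonic_small (divr_gt0 e0 s1); exists N => n /hN hn.
apply: le_trans ((hs n).2 _ Ss) _.
rewrite -(divfK (lt0r_neq0 s1) e) ler_pM ?(dot_ge0 hH) ?invr_ge0 ?ler0n//.
lra.
Qed.

End hilbert.

(** * Spectral decomposition along finite partitions *)

Section toggle.
Context (K : finType).
Implicit Types (I J A : {set K}) (i : K).

(** The sign-reversing involution behind the inclusion-exclusion cancellations below. *)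
Definition toggle i I : {set K} := if i \in I then (I :\ i)%SET else (i |: I)%SET.

Lemma in_toggle i I k : (k \in toggle i I) = (k == i) (+) (k \in I).
Proof.
rewrite /toggle; case: ifPn => iI; rewrite !inE; case: eqVneq => //= ->.
  by rewrite iI.
by rewrite (negbTE iI).
Qed.

Lemma toggleK i : involutive (toggle i).
Proof. by move=> I; apply/setP => k; rewrite !in_toggle addbA addbb addFb. Qed.

Lemma toggle_setI i I J : i \notin J -> (J :&: toggle i I = J :&: I)%SET.
Proof.
move=> iJ; apply/setP => k; rewrite !inE in_toggle.
by case: eqVneq => //= ->; rewrite (negbTE iJ).
Qed.

Lemma toggle_sub i I J : i \in J -> (toggle i I \subset J) = (I \subset J).
Proof.
move=> iJ; apply/fintype.subsetP/fintype.subsetP => IJ k.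
  have := IJ k; rewrite in_toggle; case: eqVneq => [->//|_]; exact.
by rewrite in_toggle; case: eqVneq => [->//|_]; exact: IJ.
Qed.

Lemma sub_toggle i I J : i \notin J -> (J \subset toggle i I) = (J \subset I).
Proof.
move=> iJ; apply/fintype.subsetP/fintype.subsetP => IJ k kJ; have := IJ k kJ;
  by rewrite in_toggle; case: eqVneq => [ki|//]; rewrite ki (negbTE iJ) in kJ.
Qed.

Lemma sign_toggle (R : pzRingType) i I :
  (-1) ^+ #|toggle i I| = - (-1) ^+ #|I| :> R.
Proof.
rewrite /toggle; case: ifPn => iI; last by rewrite cardsU1 iI exprS mulN1r.
by rewrite [in RHS](cardsD1 i) iI exprS mulN1r opprK.
Qed.

Lemma sum_toggle0 (R : realType) (V : lmodType R) (Pr : pred {set K})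
    (F : {set K} -> V) i :
  (forall I, Pr (toggle i I) = Pr I) ->
  (forall I, Pr I -> F (toggle i I) = - F I) -> \sum_(I | Pr I) F I = 0.
Proof.
move=> hP hF; set S := \sum_(I | _) _.
have : S = - S.
  rewrite {1}/S (reindex_inj (inv_inj (toggleK i)))/= -sumrN.
  by apply: eq_big => // I; rewrite hP; exact: hF.
move=> /eqP; rewrite -addr_eq0 -mulr2n -scaler_nat => /eqP S2.
by rewrite -(scalerK (_ : 2%:R != 0 :> R) S) ?S2 ?scaler0.
Qed.

Lemma alternating_sum (R : realType) A J :
  \sum_(I : {set K} | (A \subset I) && (I \subset J)) (-1) ^+ #|I| =
  (-1) ^+ #|A| *+ (A == J) :> R.
Proof.
have [->|AJ] := eqVneq A J.
  by rewrite (big_pred1 J)// => I; rewrite andbC -finset.eqEsubset.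
have [sAJ|sAJ] := boolP (A \subset J); last first.
  rewrite big_pred0// => I; apply/negbTE; apply: contra sAJ => /andP[].
  exact: fintype.subset_trans.
have /fintype.subsetPn[i iJ iA] : ~~ (J \subset A).
  by apply: contra AJ => JA; rewrite finset.eqEsubset sAJ.
apply: (@sum_toggle0 _ R^o _ _ i) => I; first by rewrite sub_toggle// toggle_sub.
by rewrite sign_toggle.
Qed.

End toggle.

Section projections_def.
Context (R : realType) (H : lmodType R) (dot : H -> H -> R).
Context (T : Type) (calA : set_system T).

(** The model is [Q A = E[. | F_A]]. Taking [A = B] in [bp_comp] gives idempotence, so these are
    commuting orthogonal projections; continuity from below is stated through squared norms. *)
Record boolean_projections (Q : set T -> H -> H) : Prop := {
  bp_sym : forall A x y, calA A -> dot (Q A x) y = dot x (Q A y);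
  bp_comp : forall A B x, calA A -> calA B -> Q A (Q B x) = Q (A `&` B) x;
  bp_cont : forall A_ x (e : R), (forall n, calA (A_ n)) ->
    (forall n, A_ n `<=` A_ n.+1) -> 0 < e ->
    exists n, dot (Q (\bigcup_n A_ n) x) (Q (\bigcup_n A_ n) x) -
      dot (Q (A_ n) x) (Q (A_ n) x) <= e }.

(** A finite measurable partition, possibly with empty cells. Encoding it as a map turns refinement
    into a function [pi] between colour types, along which sets of visited cells are pushed
    forward. *)
Record coloring := Coloring {
  color : finType;
  coloring_fun :> T -> color;
  coloring_meas : forall k, calA (coloring_fun @^-1` [set k]) }.

Definition cell (c : coloring) (U : {set color c}) : set T := c @^-1` [set` U].

Definition coarser (c d : coloring) : Prop :=
  exists pi : color d -> color c, forall t, c t = pi (d t).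

End projections_def.

Section colorings.
Context (T : Type) (calA : set_system T) (hA : sigma_algebra setT calA).
Local Notation coloring := (coloring calA).
Implicit Types (c d : coloring).

Lemma calA0 : calA set0. Proof. by case: hA. Qed.

Lemma calAC A : calA A -> calA (~` A).
Proof. by case: hA => _ h _ /h; rewrite setTD. Qed.

Lemma calAT : calA setT. Proof. by rewrite -setC0; exact/calAC/calA0. Qed.

Lemma calA_bigcup (A_ : nat -> set T) : (forall n, calA (A_ n)) -> calA (\bigcup_n A_ n).
Proof. by case: hA => _ _; apply. Qed.

Lemma calAU A B : calA A -> calA B -> calA (A `|` B).
Proof.
by move=> cA cB; rewrite -bigcup2E; apply: calA_bigcup => -[|[|n]]//=; exact: calA0.
Qed.

Lemma calAI A B : calA A -> calA B -> calA (A `&` B).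
Proof. by move=> cA cB; rewrite -[A]setCK -[B]setCK -setCU; apply/calAC/calAU; exact: calAC. Qed.

Lemma calAD A B : calA A -> calA B -> calA (A `\` B).
Proof. by move=> cA cB; rewrite setDE; apply: calAI => //; exact: calAC. Qed.

Lemma cell_meas c (U : {set color c}) : calA (cell U).
Proof.
have -> : cell U = \big[setU/set0]_(k in U) (c @^-1` [set k]).
  rewrite -bigcup_pred; apply/seteqP; split=> [t /= tU|t [k /= kU tk]]; last by rewrite /cell /= tk.
  by exists (c t).
by apply: big_ind => [|A B|k _]; [exact: calA0|exact: calAU|exact: coloring_meas].
Qed.

Lemma cellI c (U V : {set color c}) : cell U `&` cell V = cell (U :&: V)%SET.
Proof. by rewrite /cell; apply/seteqP; split=> t /=; rewrite inE => /andP. Qed.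

Lemma cellT c : cell [set: color c]%SET = setT.
Proof. by rewrite /cell; apply/seteqP; split=> t //= _; rewrite inE. Qed.

Lemma cellC c (U : {set color c}) : ~` cell U = cell (~: U)%SET.
Proof. by rewrite /cell; apply/seteqP; split=> t /=; rewrite inE => /negP. Qed.

Lemma cell_pull c d (pi : color d -> color c) (U : {set color c}) :
  (forall t, c t = pi (d t)) -> cell U = cell (pi @^-1: U).
Proof. by move=> h; rewrite /cell; apply/seteqP; split=> t /=; rewrite inE h. Qed.

Lemma trivial_coloring_meas (k : unit) : calA ((fun=> tt) @^-1` [set k]).
Proof.
have -> : (fun=> tt) @^-1` [set k] = [set: T]; last exact: calAT.
by apply/seteqP; split=> t //= _; case: k.
Qed.

Definition trivial_coloring : coloring := Coloring trivial_coloring_meas.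

Lemma pair_coloring_meas c d (k : color c * color d) :
  calA ((fun t => (c t, d t)) @^-1` [set k]).
Proof.
have -> : (fun t => (c t, d t)) @^-1` [set k] = c @^-1` [set k.1] `&` d @^-1` [set k.2].
  by case: k => a b; apply/seteqP; split=> t /= [-> ->].
by apply: calAI; exact: coloring_meas.
Qed.

Definition pair_coloring c d : coloring := Coloring (@pair_coloring_meas c d).

Lemma indicator_coloring_meas A (hA' : calA A) (k : bool) :
  calA ((fun t => `[< A t >]) @^-1` [set k]).
Proof.
case: k.
  have -> : (fun t => `[< A t >]) @^-1` [set true] = A; last by [].
  by apply/seteqP; split=> t /= /asboolP.
have -> : (fun t => `[< A t >]) @^-1` [set false] = ~` A; last exact: calAC.
by apply/seteqP; split=> t /=; [move=> /negbT/asboolPn|move=> /asboolF].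
Qed.

Definition indicator_coloring A (hA' : calA A) : coloring :=
  Coloring (indicator_coloring_meas hA').

Lemma coarser_refl c : coarser c c. Proof. by exists id. Qed.

Lemma coarser_trans c d e : coarser c d -> coarser d e -> coarser c e.
Proof.
by move=> [pi h] [ro g]; exists (pi \o ro) => t; rewrite h g.
Qed.

Lemma coarser_pairl c d : coarser c (pair_coloring c d).
Proof. by exists fst. Qed.

Lemma coarser_pairr c d : coarser d (pair_coloring c d).
Proof. by exists snd. Qed.

Lemma coarser_dir c d : exists e, coarser c e /\ coarser d e.
Proof. by exists (pair_coloring c d); split; [exact: coarser_pairl|exact: coarser_pairr]. Qed.

End colorings.

Section spectral_pieces.
Context (R : realType) (H : lmodType R) (dot : H -> H -> R) (hH : hilbert dot).
Context (T : Type) (calA : set_system T) (hA : sigma_algebra setT calA).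
Context (Q : set T -> H -> H) (hQ : boolean_projections dot calA Q).
Local Notation coloring := (coloring calA).
Local Notation "<[ x , y ]>" := (dot x y) (format "<[ x ,  y ]>").
Local Notation sqn x := (dot x x).
Implicit Types (c d : coloring).

Lemma Qsym A x y : calA A -> <[Q A x, y]> = <[x, Q A y]>.
Proof. exact: (bp_sym hQ). Qed.

Lemma QB A x y : calA A -> Q A (x - y) = Q A x - Q A y.
Proof. by move=> cA; apply: (symB hH) => u v; exact: Qsym. Qed.

Lemma QZ A a x : calA A -> Q A (a *: x) = a *: Q A x.
Proof. by move=> cA; apply: (symZ hH) => u v; exact: Qsym. Qed.

Lemma Q_sum A I (r : seq I) (Pr : pred I) (F : I -> H) : calA A ->
  Q A (\sum_(i <- r | Pr i) F i) = \sum_(i <- r | Pr i) Q A (F i).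
Proof. by move=> cA; apply: (sym_sum hH) => u v; exact: Qsym. Qed.

Lemma QQ A x : calA A -> Q A (Q A x) = Q A x.
Proof. by move=> cA; rewrite (bp_comp hQ)// setIid. Qed.

Lemma Q_mono A B x : calA A -> calA B -> A `<=` B -> sqn (Q A x) <= sqn (Q B x).
Proof.
move=> cA cB AB; have -> : Q A x = Q A (Q B x).
  by rewrite (bp_comp hQ)// (setIidl AB).
by apply: (sym_idem_le hH) => [u v|]; [exact: Qsym|exact: QQ].
Qed.

(* The component of [x] whose spectrum meets exactly the cells in [J]. *)
Definition piece c (J : {set color c}) x : H :=
  \sum_(I : {set color c} | I \subset J) (-1) ^+ (#|J| + #|I|) *: Q (cell I) x.

Lemma sum_sign (V : lmodType R) (K : finType) (A J : {set K}) (v : V) :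
  \sum_(I : {set K} | (A \subset I) && (I \subset J)) (-1) ^+ (#|J| + #|I|) *: v =
  if A == J then v else 0.
Proof.
under eq_bigr do rewrite exprD -scalerA.
rewrite -scaler_sumr -scaler_suml alternating_sum.
case: eqP => [->|]; last by rewrite scale0r scaler0.
by rewrite scalerA -expr2 sqrr_sign scale1r.
Qed.

(** Uniqueness in Moebius inversion: pieces are identified by their sums over the subsets of each
    [U], without handling signs again. *)
Lemma pieceP c x (y : {set color c} -> H) :
  (forall U, Q (cell U) x = \sum_(L : {set color c} | L \subset U) y L) ->
  forall J, piece J x = y J.
Proof.
move=> hy J; rewrite /piece.
under eq_bigr do rewrite hy scaler_sumr.
rewrite (exchange_big_dep predT)//=.
rewrite (eq_bigr (fun L => if L == J then y L else 0)) => [|L _]; last first.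
  by rewrite -sum_sign; apply: eq_bigl => I; rewrite andbC.
by rewrite -big_mkcond/= big_pred1_eq.
Qed.

(** If some [i] in [J] is outside [U], toggling [i] in [I] leaves the intersection of [U] and [I]
    unchanged and flips the sign, so everything cancels. *)
Lemma Q_piece c (U J : {set color c}) x :
  Q (cell U) (piece J x) = if J \subset U then piece J x else 0.
Proof.
have cm := cell_meas hA.
rewrite /piece Q_sum//.
under eq_bigr do rewrite QZ// (bp_comp hQ)// cellI.
case: ifPn => [JU|/fintype.subsetPn[i iJ iU]].
  by apply: eq_bigr => I IJ; rewrite (finset.setIidPr (fintype.subset_trans IJ JU)).
apply: (sum_toggle0 (i := i)) => I; first exact: toggle_sub.
by move=> _; rewrite toggle_setI// !exprD sign_toggle mulrN scaleNr.
Qed.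

Lemma Q_cell_sum c (U : {set color c}) x :
  Q (cell U) x = \sum_(J : {set color c} | J \subset U) piece J x.
Proof.
rewrite /piece (exchange_big_dep (fun I : {set color c} => I \subset U))/=; last first.
  by move=> J I JU IJ; exact: fintype.subset_trans JU.
rewrite (bigD1 U)//= [X in _ + X]big1 ?addr0; last first.
  move=> I /andP[IU /negbTE nIU]; rewrite -scaler_suml.
  rewrite (eq_bigr _ (fun J _ => exprD _ _ _)) -mulr_suml.
  rewrite (eq_bigl (fun J : {set color c} => (I \subset J) && (J \subset U))).
    by rewrite alternating_sum nIU mul0r scale0r.
  by move=> J; rewrite andbC.
rewrite (big_pred1 U) => [|J]; last by rewrite -finset.eqEsubset.
by rewrite addnn -signr_odd odd_double scale1r.
Qed.

Lemma pieceC c (J L : {set color c}) x :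
  piece J (piece L x) = if J == L then piece L x else 0.
Proof.
rewrite {1}/piece; under eq_bigr do rewrite Q_piece fun_if scaler0.
by rewrite -big_mkcondr/= eq_sym -sum_sign; apply: eq_bigl => I; rewrite andbC.
Qed.

Lemma piece_sym c (J : {set color c}) x y : <[piece J x, y]> = <[x, piece J y]>.
Proof.
rewrite (dot_suml hH) (dot_sumr hH); apply: eq_bigr => I _.
by rewrite (dotZl hH) (dotZr hH) Qsym//; exact: cell_meas.
Qed.

(* The component of [x] whose set of visited cells satisfies [Pr]. *)
Definition event c (Pr : pred {set color c}) x : H := \sum_(J | Pr J) piece J x.

Lemma event_sym c (Pr : pred {set color c}) x y :
  <[event Pr x, y]> = <[x, event Pr y]>.
Proof. by rewrite (dot_suml hH) (dot_sumr hH); apply: eq_bigr => J _; exact: piece_sym. Qed.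

Lemma eventC c (Pr Pr' : pred {set color c}) x :
  event Pr (event Pr' x) = event (predI Pr Pr') x.
Proof.
rewrite /event; under eq_bigr => J _.
  rewrite (sym_sum hH (piece_sym J)).
  under eq_bigr do rewrite pieceC eq_sym.
  rewrite -big_mkcondr/= (eq_bigl (fun L : {set color c} => (L == J) && Pr' J)); last first.
    by move=> L; rewrite andbC; case: eqP => //= ->.
  over.
rewrite (eq_bigr (fun J => if Pr' J then piece J x else 0)) => [|J _]; last first.
  case: ifP => h; first by rewrite (big_pred1 J)// => L; rewrite andbT.
  by rewrite big_pred0// => L; rewrite andbF.
by rewrite -big_mkcondr.
Qed.

Lemma Q_event c (U : {set color c}) x :
  Q (cell U) x = event (fun J : {set color c} => J \subset U) x.
Proof. exact: Q_cell_sum. Qed.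

Lemma event_idem c (Pr : pred {set color c}) x : event Pr (event Pr x) = event Pr x.
Proof. by rewrite eventC; apply: eq_bigl => J /=; rewrite andbb. Qed.

Lemma sqn_event c (Pr : pred {set color c}) x :
  sqn (event Pr x) = \sum_(J | Pr J) sqn (piece J x).
Proof.
rewrite (sym_idem_sqn hH (@event_sym _ _) (event_idem _ _)) (dot_suml hH).
apply: eq_bigr => J _; rewrite (sym_idem_sqn hH (@piece_sym _ _))//.
by rewrite pieceC eqxx.
Qed.

(** A coarse cell is visited exactly when one of its subcells is, so the coarse visited set is the
    image of the fine one. *)
Lemma piece_refine c d (pi : color d -> color c) (J : {set color c}) x :
  (forall t, c t = pi (d t)) ->
  piece J x = event (fun L : {set color d} => pi @: L == J)%SET x.
Proof.
move=> cd; move: J; apply: pieceP => U.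
rewrite (cell_pull _ cd) Q_cell_sum.
rewrite (partition_big (fun L : {set color d} => pi @: L)%SET
  (fun J : {set color c} => J \subset U))/=.
  apply: eq_bigr => J JU; apply: eq_bigl => L.
  rewrite -sub_imset_pre; case: (altP eqP) => [E|_]; last by rewrite andbF.
  by rewrite E JU.
by move=> L; rewrite sub_imset_pre.
Qed.

Lemma event_refine c d (pi : color d -> color c) (Pr : pred {set color c}) x :
  (forall t, c t = pi (d t)) ->
  event Pr x = event (fun L : {set color d} => Pr (pi @: L)%SET) x.
Proof.
move=> cd; rewrite /event; under eq_bigr do rewrite (piece_refine _ _ cd).
rewrite [RHS](partition_big (fun L : {set color d} => pi @: L)%SET Pr)//=.
apply: eq_bigr => J PJ; apply: eq_bigl => L.
by case: eqP => [->|]; rewrite ?andbF ?PJ.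
Qed.

End spectral_pieces.

(** * Finiteness of spectral sets *)

(* For a uniformly random colouring of [K], each [J] meeting [U] in at least
   [M] points misses a given colour in [U] with probability at most [rho ^ M]. *)
Lemma exists_good_coloring (R : realType) (K : finType) (w : {set K} -> R)
    (U : {set K}) (M r : nat) (rho := r%:R / r.+1%:R : R) :
  (forall J, 0 <= w J) ->
  exists chi : {ffun K -> 'I_r.+1}, forall i,
    \sum_(J : {set K} | (M <= #|J :&: U|)%N && [forall k in J :&: U, chi k != i]) w J
    <= r.+1%:R * rho ^+ M * \sum_(J : {set K}) w J.
Proof.
move=> w0; pose B := r.+1%:R * rho ^+ M * \sum_(J : {set K}) w J.
pose X (chi : {ffun K -> 'I_r.+1}) i := \sum_(J : {set K} |
  (M <= #|J :&: U|)%N && [forall k in J :&: U, chi k != i]) w J.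
(* If every colouring failed, the missed weight summed over colours would always exceed [B], while
   its mean is at most [B]; the factor [r.+1] in [B] counts the colours. *)
apply: contrapT => /forallNP noX.
have X0 chi i : 0 <= X chi i by apply: sumr_ge0.
have BX chi : B < \sum_i X chi i.
  have /existsNP[i /negP] := noX chi; rewrite -ltNge -/B => /lt_le_trans; apply.
  by rewrite (bigD1 i)//= lerDl sumr_ge0.
pose n := r.+1%:R : R; have n0 : 0 < n by rewrite ltr0Sn.
have rho0 : 0 <= rho by rewrite divr_ge0.
have rho1 : rho <= 1 by rewrite ler_pdivrMr// mul1r ler_nat.
(* The probability of one colouring, written as a product over points so that a sum over colourings
   distributes into independent choices. *)
pose al : R := \prod_(k : K) n^-1.
have total : \sum_(chi : {ffun K -> 'I_r.+1}) al = 1.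
  rewrite /al -(bigA_distr_bigA (fun=> fun=> n^-1))/=; apply: big1 => k _.
  by rewrite sumr_const card_ord -mulr_natl mulfV// lt0r_neq0.
have avg : \sum_(chi : {ffun K -> 'I_r.+1}) al * \sum_i X chi i <= B.
  under eq_bigr do rewrite mulr_sumr; rewrite exchange_big/=.
  have -> : B = \sum_(i < r.+1) rho ^+ M * \sum_J w J.
    by rewrite sumr_const card_ord -mulr_natl mulrA.
  apply: ler_sum => i _.
  under eq_bigr do rewrite /X big_mkcond/= mulr_sumr.
  rewrite exchange_big mulr_sumr; apply: ler_sum => J _ /=.
  case: (leqP M #|J :&: U|) => [MJ|_]; last first.
    by rewrite big1 ?mulr_ge0 ?exprn_ge0// => chi _; rewrite mulr0.
  (* Summed over [v], the factor [g k] is [rho] for [k] in both [J] and [U], and 1 otherwise. *)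
  pose g (k : K) (v : 'I_r.+1) : R := n^-1 * ((k \in J :&: U) ==> (v != i))%:R.
  rewrite (eq_bigr (fun chi : {ffun K -> 'I_r.+1} => w J * \prod_k g k (chi k))); last first.
    move=> chi _; rewrite /g big_split/= -/al mulrCA; congr (_ * _).
    case: ifPn => [/forallP h|]; first by rewrite big1 ?mulr1// => k _; rewrite (h k).
    rewrite negb_forall => /existsP[k hk].
    by rewrite (bigD1 k)//= (negbTE hk) mul0r mulr0.
  rewrite -mulr_sumr mulrC ler_wpM2r// -bigA_distr_bigA/=.
  have -> : \prod_(k : K) \sum_(v : 'I_r.+1) g k v = rho ^+ #|J :&: U|.
    rewrite -prodr_const [RHS]big_mkcond/=; apply: eq_bigr => k _.
    rewrite /g -mulr_sumr; case: (k \in J :&: U) => /=; last first.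
      by rewrite sumr_const card_ord mulVf// lt0r_neq0.
    rewrite mulrC; congr (_ / _); rewrite (bigD1 i)//= eqxx add0r.
    rewrite (eq_bigr (fun=> 1)) => [|v ->//].
    rewrite sumr_const; congr (_%:R).
    apply: etrans (etrans (cardC1 i) (congr1 predn (card_ord _))).
    by apply: eq_card => v; rewrite !inE.
  by rewrite -(subnKC MJ) exprD ler_piMr ?exprn_ge0// exprn_ile1.
have : B < B.
  apply: lt_le_trans avg; rewrite -[ltLHS]mul1r -total mulr_suml.
  apply: ltr_sum => [|chi _]; last by rewrite /al ltr_pM2l// prodr_gt0// => k _; rewrite invr_gt0.
  by apply/hasP; exists [ffun=> ord0]; rewrite ?mem_index_enum.
by rewrite ltxx.
Qed.

Section classicality.
Context (R : realType) (H : lmodType R) (dot : H -> H -> R) (hH : hilbert dot).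
Context (T : Type) (calA : set_system T) (hA : sigma_algebra setT calA).
Context (Q : set T -> H -> H) (hQ : boolean_projections dot calA Q).
Context (f : H) (Qf : Q setT f = f).
Local Notation coloring := (coloring calA).
Local Notation "<[ x , y ]>" := (dot x y) (format "<[ x ,  y ]>").
Local Notation sqn x := (dot x x).
Local Notation event := (event Q).
Implicit Types (c d : coloring).

Definition mass c (Pr : pred {set color c}) : R := sqn (event Pr f).

Lemma massE c (Pr : pred {set color c}) :
  mass Pr = \sum_(J | Pr J) sqn (piece Q J f).
Proof. exact: (sqn_event hH hA hQ). Qed.

Lemma mass_refine c d (pi : color d -> color c) (Pr : pred {set color c}) :
  (forall t, c t = pi (d t)) ->
  mass Pr = mass (fun L : {set color d} => Pr (pi @: L)%SET).
Proof. by move=> cd; rewrite /mass (event_refine Q _ _ cd). Qed.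

Lemma eventT c : event (fun _ : {set color c} => true) f = f.
Proof.
rewrite -[RHS]Qf -(cellT c) (Q_event Q [set: color c]%SET).
by apply: eq_bigl => J; rewrite finset.subsetT.
Qed.

Lemma massT c : mass (fun _ : {set color c} => true) = sqn f.
Proof. by rewrite /mass eventT. Qed.

Lemma piece_ge0 c (J : {set color c}) : 0 <= sqn (piece Q J f).
Proof. exact: (dot_ge0 hH). Qed.
Hint Resolve piece_ge0 : core.

Lemma le_mass c (P1 P2 : pred {set color c}) :
  (forall J, P1 J -> P2 J) -> mass P1 <= mass P2.
Proof.
move=> h; rewrite !massE [leLHS]big_mkcond [leRHS]big_mkcond/=.
by apply: ler_sum => J _; case: ifPn => [/h ->//|_]; case: ifP.
Qed.

Lemma mass_leD c (P0 P1 P2 : pred {set color c}) :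
  (forall J, P0 J -> P1 J || P2 J) -> mass P0 <= mass P1 + mass P2.
Proof.
move=> h; rewrite !massE big_mkcond [in leRHS]big_mkcond [X in _ + X]big_mkcond/=.
rewrite -big_split/=; apply: ler_sum => J _.
case: ifPn => [/h|_]; last by rewrite addr_ge0//; case: ifP.
by case: (P1 J) => /=; [rewrite lerDl; case: ifP|move=> ->; rewrite add0r].
Qed.

(* The mass of the spectral sets hitting [A]. *)
Definition hit (A : set T) : R := sqn f - sqn (Q (~` A) f).

Lemma hit_cell c (U : {set color c}) :
  hit (cell U) = mass (fun J => J :&: U != finset.set0)%SET.
Proof.
rewrite /hit cellC (Q_event Q (~: U)%SET) -/(mass _) -(massT c).
rewrite !massE (bigID (fun J : {set color c} => J :&: U != finset.set0)%SET)/=.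
rewrite -addrA [X in _ + X](_ : _ = 0) ?addr0//; apply/eqP; rewrite subr_eq0; apply/eqP.
by apply/eq_bigl => J; rewrite /= negbK finset.setI_eq0 finset.disjoints_subset.
Qed.

(* Spectral sets of mass at least [x] have infinite trace on [D]. *)
Definition infinite_mass (D : set T) (x : R) : Prop :=
  forall M, exists c (U : {set color c}), cell U = D /\
    x <= mass (fun J : {set color c} => (M <= #|J :&: U|)%N).

Lemma infinite_mass_split D x y : 0 < y -> y < x -> infinite_mass D x ->
  exists E, [/\ calA E, E `<=` D, y <= hit E & infinite_mass (D `\` E) y].
Proof.
move=> y0 yx Dx.
have x0 : 0 < x by apply: lt_trans yx.
have cellm := cell_meas hA.
(* The final double count gives [r * x] strictly below [r.+1 * y], which this choice of [r]
   contradicts. *)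
have [r hr] : exists r : nat, y * r.+1%:R <= r%:R * x.
  exists (Num.truncn (y / (x - y))).+1; set n := (Num.truncn _).+1.
  have : y / (x - y) < n%:R by exact: truncnS_gt.
  rewrite ltr_pdivrMr ?subr_gt0// => h.
  by rewrite -addn1 natrD; lra.
have r1 : r%:R / r.+1%:R < 1 :> R by rewrite ltr_pdivrMr// mul1r ltr_nat.
(* Among spectral sets with at least [M] visited cells in [U], those missing a given colour will
   have mass at most [x - y]. *)
have [M hM] := @geometric_small _ (r%:R / r.+1%:R) (r.+1%:R * sqn f) (x - y)
  (divr_ge0 (ler0n _ _) (ler0n _ _)) r1 (eqbRL (subr_gt0 _ _) yx).
have [c [U [UD xM]]] := Dx M.
have [chi hchi] := @exists_good_coloring R _ (fun J => sqn (piece Q J f)) U M r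
  (fun J => piece_ge0 J).
pose Ui i := (U :&: [set k | chi k == i])%SET.
have hit_i i : y <= hit (cell (Ui i)).
  rewrite hit_cell.
  suff : x <= mass (fun J => J :&: Ui i != finset.set0)%SET + (x - y) by lra.
  apply: le_trans xM _.
  apply: le_trans (@mass_leD c _ (fun J => J :&: Ui i != finset.set0)%SET
    (fun J : {set color c} => (M <= #|J :&: U|)%N &&
      [forall k in J :&: U, chi k != i]%SET) _) _.
    move=> J MJ; rewrite MJ/= -implyNb negbK; apply/implyP => /eqP Ji.
    apply/forall_inP => k; rewrite inE => /andP[kJ kU]; apply/negP => ki.
    by have : k \in (J :&: Ui i)%SET by [rewrite !inE kJ kU ki]; rewrite Ji inE.
  rewrite lerD2l [leLHS]massE; apply: le_trans (hchi i) _.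
  rewrite -massE massT; apply: le_trans hM.
  by rewrite le_eqVlt; apply/orP; left; apply/eqP; ring.
suff [i hi] : exists i, infinite_mass (D `\` cell (Ui i)) y.
  exists (cell (Ui i)); split=> //.
  by rewrite -UD /cell => t /=; rewrite inE => /andP[].
apply: contrapT => /forallNP noi.
have /choice[m hm] : forall i, exists m, forall c' (U' : {set color c'}),
    cell U' = D `\` cell (Ui i) -> mass (fun J : {set color c'} => (m <= #|J :&: U'|)%N) < y.
  move=> i; have /existsNP[m /forallNP hm] := noi i.
  exists m => c' U' U'D; rewrite ltNge; apply/negP => yU'.
  by apply: (hm c'); exists U'.
(* [mm] depends on the colouring, hence on [c]. A second partition [c1] therefore exhibits the
   [2 mm] visited cells, and the two are compared on their common refinement [e]. *)
pose mm := \max_i m i.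
have [c1 [U1 [U1D xU1]]] := Dx (mm + mm)%N.
pose e := pair_coloring hA c1 c.
have e1 t : c1 t = fst (e t) by [].
have e2 t : c t = snd (e t) by [].
pose V := (fst @^-1: U1 : {set color e})%SET.
pose W i := (V :\: (snd @^-1: Ui i))%SET : {set color e}.
have VD : cell V = D by rewrite -U1D (cell_pull _ e1).
have WD i : cell (W i) = D `\` cell (Ui i).
  by rewrite /W finset.setDE -cellI -cellC -(cell_pull _ e2) VD setDE.
pose big k (S : {set color e}) : pred {set color e} := fun J => (k <= #|J :&: S|)%N.
have xV : x <= mass (big (mm + mm)%N V).
  apply: le_trans xU1 _; rewrite (mass_refine _ e1); apply: le_mass => J /=.
  move=> /leq_trans; apply; apply: leq_trans (leq_imset_card fst _).
  apply/subset_leq_card/fintype.subsetP => k; rewrite inE => /andP[/imsetP[l lJ ->] lU].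
  by apply: imset_f; rewrite !inE lJ.
have Wy i : mass (big mm (W i)) < y.
  apply: le_lt_trans (hm i _ _ (WD i)); apply: le_mass => J.
  by apply: leq_trans; exact: leq_bigmax.
(* For distinct colours [W i] and [W j] cover [V], so [2 mm] visited cells in [V] cannot leave fewer
   than [mm] in each. *)
have two J i j : big (mm + mm)%N V J -> ~~ big mm (W i) J -> ~~ big mm (W j) J -> i = j.
  rewrite /big -!ltnNge => h hi hj; apply: contraTeq h => ij; rewrite -ltnNge.
  apply: leq_ltn_trans (_ : #|(J :&: W i) :|: (J :&: W j)| < _)%N; last first.
    by rewrite (leq_ltn_trans (leq_card_setU _ _))// -addSn leq_add// ltnW.
  apply/subset_leq_card/fintype.subsetP => k; rewrite /W /V /Ui !inE.
  case/andP => -> ->; rewrite !andbT/= -negb_and; apply/negP.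
  by case/andP=> /andP[_ /eqP ki] /andP[_ /eqP kj]; rewrite -ki -kj eqxx in ij.
(* Each spectral set that is large on [V] is counted by at least [r] of the [r.+1] classes. *)
have : r%:R * x <= \sum_i mass (big mm (W i)).
  apply: le_trans (ler_wpM2l (ler0n _ _) xV) _.
  under eq_bigr do rewrite massE big_mkcond; rewrite exchange_big/= massE mulr_sumr.
  rewrite big_mkcond/=; apply: ler_sum => J _; case: ifPn => [bJ|_]; last first.
    by apply: sumr_ge0 => i _; case: ifP.
  have [/forallP hJ|] := boolP [forall i, big mm (W i) J].
    rewrite (eq_bigr (fun=> sqn (piece Q (J : {set color e}) f))) => [|i _]; last by rewrite hJ.
    by rewrite sumr_const card_ord -[leRHS]mulr_natl ler_wpM2r// ler_nat.
  rewrite negb_forall => /existsP[i nbi]; rewrite (bigD1 i)//= (negbTE nbi) add0r.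
  rewrite (eq_bigr (fun=> sqn (piece Q (J : {set color e}) f))) => [|j ji]; last first.
    by case: ifPn => // nbj; rewrite (two _ _ _ bJ nbi nbj) eqxx in ji.
  rewrite sumr_const -[leRHS]mulr_natl ler_wpM2r// ler_nat.
  by rewrite (etrans (cardC1 i) (congr1 predn (card_ord _))).
apply/negP; rewrite -ltNge; apply: lt_le_trans hr.
apply: lt_le_trans (_ : \sum_(i < r.+1) y <= _).
  by apply: ltr_sum => //; apply/hasP; exists ord0; rewrite ?mem_index_enum.
by rewrite sumr_const card_ord mulr_natr.
Qed.

(* Otherwise [infinite_mass_split] produces disjoint sets with hitting mass
   bounded away from zero, against the continuity of the projections. *)
Lemma infinite_mass_le0 x : 0 < x -> ~ infinite_mass setT x.
Proof.
(* The strict slack [x / 2 < z] allows endless iteration: each split only descends to the midpoint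
   of [z] and [x / 2]. *)
move=> x0 Tx; pose good D := calA D /\ exists2 z, x / 2 < z & infinite_mass D z.
have step (D : {D | good D}) : exists D' : {D | good D},
    sval D' `<=` sval D /\ x / 2 <= hit (sval D `\` sval D').
  case: D => D [cD [z xz Dz]] /=.
  have [||E [cE ED yE DE]] := @infinite_mass_split D z ((z + x / 2) / 2) _ _ Dz; try lra.
  have gDE : good (D `\` E).
    by split; [exact: calAD|exists ((z + x / 2) / 2) => //; lra].
  exists (exist _ _ gDE); split => /=; first exact: subDsetl.
  by rewrite setDD (setIidr ED); lra.
have [g hg] := choice step.
have gT : good setT by split; [exact: calAT|exists x => //; lra].
pose D n := sval (iter n g (exist _ _ gT)).
have cD n : calA (D n) by rewrite /D; case: (iter _ _ _) => ? [].
have DS n : D n.+1 `<=` D n by rewrite /D /=; case: (hg (iter n g (exist _ _ gT))).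
have hitD n : x / 2 <= hit (D n `\` D n.+1).
  by rewrite /D /=; case: (hg (iter n g (exist _ _ gT))).
pose L := \bigcap_n D n.
have cL : calA L.
  rewrite -[L]setCK setC_bigcap; apply: calAC => //; apply: calA_bigcup => // n.
  exact: calAC.
(* The intersection [L] of the [D n] may be nonempty; removing it makes these complements increase
   to the whole space. *)
pose A_ n := ~` (D n `\` L).
have cA n : calA (A_ n) by apply: calAC => //; exact: calAD.
have AS n : A_ n `<=` A_ n.+1 by apply: subsetC; apply: setSD.
have AT : \bigcup_n A_ n = setT.
  rewrite /A_ -setC_bigcap -[RHS]setC0; congr (~` _).
  apply/seteqP; split=> // t h; have [_] := h 0%N I; apply => n _.
  by have [] := h n I.
(* Continuity at level [x / 4] is incompatible with mass at least [x / 2] hitting the part of [D n]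
   outside [D n.+1], which avoids [L]. *)
have [n] := bp_cont hQ f cA AS (divr_gt0 x0 (ltr0Sn R 3)).
rewrite AT Qf; apply/negP; rewrite -ltNge.
have h := Q_mono hH hQ f (cA n) (calAC hA (calAD hA (cD n) (cD n.+1))).
have /h{}h : A_ n `<=` ~` (D n `\` D n.+1).
  by apply: subsetC => t [Dt nDt]; split=> // Lt; apply: nDt; exact: Lt.
have := hitD n; rewrite /hit; lra.
Qed.

End classicality.

(** * Stable partitions and the first chaos *)

Section thinning.
Context (R : realType) (H : lmodType R) (dot : H -> H -> R) (hH : hilbert dot).
Context (T : Type) (calA : set_system T) (hA : sigma_algebra setT calA).
Context (Q : set T -> H -> H) (hQ : boolean_projections dot calA Q).
Local Notation coloring := (coloring calA).
Local Notation "<[ x , y ]>" := (dot x y) (format "<[ x ,  y ]>").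
Local Notation sqn x := (dot x x).
Local Notation event := (event Q).
Implicit Types (c d : coloring).

Lemma sqn_piece_refine c d (pi : color d -> color c) (J : {set color c}) x :
  (forall t, c t = pi (d t)) ->
  sqn (piece Q J x) = \sum_(L : {set color d} | pi @: L == J) sqn (piece Q L x).
Proof. by move=> cd; rewrite (piece_refine Q _ _ cd) (sqn_event hH hA hQ). Qed.

(** A refinement that splits a visited cell lowers [2^-|A|] by a definite amount:
    [2^-b - 2^-a >= 2^-a >= 2^-M] when [b < a < M]. *)
Lemma imset_lt_gap (K L : finType) (pi : L -> K) (A : {set L}) (M : nat) :
  (#|pi @: A| < #|A|)%N -> (#|A| < M)%N ->
  1 <= 2 ^+ M * (2^-1 ^+ #|pi @: A| - 2^-1 ^+ #|A|) :> R.
Proof.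
move: #|A| #|pi @: A| => a b ba aM.
have -> : 2 ^+ M = 2 ^+ (M - a) * 2 ^+ a :> R by rewrite -exprD subnK// ltnW.
rewrite -mulrA mulrBr -exprMn divff// expr1n.
have -> : 2 ^+ a * 2^-1 ^+ b = 2 ^+ (a - b) :> R.
  by rewrite -{1}(subnK (ltnW ba)) exprD -mulrA -exprMn divff// expr1n mulr1.
have e1 n : (0 < n)%N -> 2 <= 2 ^+ n :> R.
  by case: n => // n _; rewrite exprS ler_peMr// exprn_ege1// ler1n.
have := e1 _ (eqbRL (subn_gt0 _ _) ba); have := e1 _ (eqbRL (subn_gt0 _ _) aM).
by move: (2 ^+ _) (2 ^+ _) => u v; nra.
Qed.

(* The colouring almost minimises the expectation of [2 ^- #|J|], which can only
   decrease under refinement. *)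
Lemma stable_coloring f (e : R) : Q setT f = f -> 0 < e ->
  exists c, forall d (pi : color d -> color c), (forall t, c t = pi (d t)) ->
    sqn (event (fun L : {set color d} => (#|pi @: L| < #|L|)%N) f) <= e.
Proof.
move=> Qf e0; have e2 : 0 < e / 2 by lra.
(* Half of [e] pays for spectral sets with at least [M] visited cells, uniformly in the partition;
   the other half pays for splittings of smaller ones. *)
have /existsNP[M hM] := infinite_mass_le0 hH hA hQ Qf e2.
have massM c : mass dot Q f (fun J : {set color c} => (M <= #|J|)%N) <= e / 2.
  rewrite leNgt; apply/negP => /ltW h; apply: hM; exists c, [set: color c]%SET.
  split; first exact: cellT.
  apply: le_trans h _; apply: (le_mass hH hA hQ) => J.
  by rewrite (finset.setIT J).
pose Theta c := \sum_(J : {set color c}) 2^-1 ^+ #|J| * sqn (piece Q J f).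
have Theta_refine c d (pi : color d -> color c) : (forall t, c t = pi (d t)) ->
    Theta c = \sum_(L : {set color d}) 2^-1 ^+ #|pi @: L| * sqn (piece Q L f).
  move=> cd; rewrite /Theta [RHS](partition_big (fun L : {set color d} => pi @: L)%SET xpredT)//=.
  apply: eq_bigr => J _; rewrite (sqn_piece_refine _ _ cd) mulr_sumr.
  by apply: eq_bigr => L /eqP ->.
pose S : set R := fun r => exists c, r = Theta c.
have Theta0 c : 0 <= Theta c.
  by apply: sumr_ge0 => J _; rewrite mulr_ge0 ?exprn_ge0 ?(dot_ge0 hH).
have S0 : has_inf S.
  split; first by exists (Theta (trivial_coloring hA)), (trivial_coloring hA).
  by exists 0 => _ [c ->].
have S_ge c : inf S <= Theta c by apply: ge_inf; [exact: S0.2|exists c].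
have pM : 0 < 2 ^+ M :> R by rewrite exprn_gt0.
(* The tolerance [e / 2 / 2 ^+ M] offsets the factor in [imset_lt_gap]. *)
have [_ [c ->] hc] := inf_adherent (divr_gt0 e2 pM) S0.
exists c => d pi cd; rewrite -/(mass dot Q f _).
apply: le_trans (@mass_leD _ _ _ hH _ _ hA _ hQ f d _ (fun L : {set color d} => (M <= #|L|)%N)
  (fun L : {set color d} => (#|pi @: L| < #|L|)%N && (#|L| < M)%N) _) _.
  by move=> L ->; rewrite leqNgt; case: leqP.
have := massM d; set u := mass _ _ _ _ => hu.
suff : mass dot Q f (fun L : {set color d} => (#|pi @: L| < #|L|)%N && (#|L| < M)%N) <= e / 2.
  lra.
apply: le_trans (_ : 2 ^+ M * (Theta c - Theta d) <= _); last first.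
  rewrite mulrC -ler_pdivlMr//; have := S_ge d; lra.
rewrite (Theta_refine _ _ _ cd) /Theta -sumrB mulr_sumr (massE hH hA hQ) big_mkcond/=.
apply: ler_sum => L _; rewrite -mulrBl mulrA.
have wL : 0 <= sqn (piece Q L f) by exact: (dot_ge0 hH).
case: ifPn => [/andP[h1 h2]|_]; first by rewrite ler_peMl// imset_lt_gap.
rewrite !mulr_ge0// ?exprn_ge0// subr_ge0 ler_wiXn2l// ?invr_ge0//.
  by rewrite invf_le1// ler1n.
exact: leq_imset_card.
Qed.

(** The cardinality condition says that [fst] is injective on [L]: no cell of [c] contains two
    visited cells of the common refinement. *)
Definition injective_event c d x : H :=
  event (fun L : {set color (pair_coloring hA c d)} => #|fst @: L| == #|L|)%SET x.

(** Injectivity on a finer partition implies injectivity on a coarser one, so these projections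
    decrease and [decreasing_net_cvg] applies. *)
Lemma injective_event_net c d d' x : coarser d d' ->
  <[injective_event c d x, injective_event c d' x]> = sqn (injective_event c d' x).
Proof.
move=> [pi dd']; rewrite /injective_event.
pose pi2 (p : color (pair_coloring hA c d')) : color (pair_coloring hA c d) :=
  (p.1, pi p.2).
rewrite (@event_refine _ _ _ _ Q _ _ pi2) => [|t]; last by rewrite /pi2/= dd'.
rewrite !(event_sym hH hA hQ) !(eventC hH hA hQ).
congr dot; apply: eq_bigl => L /=; rewrite andbb.
apply: andb_idl => /eqP h; have fstE : fst @: (pi2 @: L) = fst @: L.
  by rewrite -imset_comp.
by rewrite eqn_leq leq_imset_card fstE h leq_imset_card.
Qed.

(* Spectral sets visiting at most one cell of [d] inside [A]. *)
Definition thin A d x : H := Q (~` A) x +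
  \sum_(l : color d) (Q (~` A `|` (A `&` d @^-1` [set l])) x - Q (~` A) x).

(** With no visited cell in [A] only the first term counts; with exactly one, say [l], only the
    [l]-th summand; with two or more, every term vanishes. *)
Lemma thin_event c d k x : thin (c @^-1` [set k]) d x =
  event (fun L : {set color (pair_coloring hA c d)} =>
    #|[set p in L | p.1 == k]| <= 1)%N x.
Proof.
set e := pair_coloring hA c d; set A := c @^-1` [set k].
have eventE (Pr : pred {set color e}) :
    event Pr x = \sum_L (Pr L)%:R *: piece Q L x.
  by rewrite /event big_mkcond; apply: eq_bigr => L _; case: (Pr L);
    rewrite ?scale1r ?scale0r.
pose X : {set color e} := [set p | p.1 != k]%SET.
pose Xl l : {set color e} := [set p | (p.1 != k) || (p.2 == l)]%SET.
have XE : ~` A = cell X.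
  by apply/seteqP; split=> t; rewrite /cell /= inE /= => /eqP.
have XlE l : cell X `|` (A `&` d @^-1` [set l]) = cell (Xl l).
  rewrite -XE; apply/seteqP; split=> t; rewrite /cell /= inE /=.
    by case=> [/eqP ->//|[_ /eqP ->]]; rewrite orbT.
  case: (eqVneq (c t) k) => [ctk /= /eqP dtl|/eqP ctk _]; [by right|by left].
rewrite /thin XE; under eq_bigr do rewrite XlE.
rewrite !(Q_event Q) !eventE.
under eq_bigr do rewrite (Q_event Q) eventE -sumrB; rewrite exchange_big -big_split/=.
apply: eq_bigr => L _; under eq_bigr do rewrite -scalerBl.
rewrite -scaler_suml -scalerDl; congr (_ *: _).
set S := [set p in L | p.1 == k]%SET.
have LX : (L \subset X) = (S == finset.set0).
  apply/idP/eqP => [/fintype.subsetP h|h].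
    by apply/setP => p; rewrite !inE; apply/negP => /andP[/h]; rewrite inE => /negbTE ->.
  apply/fintype.subsetP => p pL; rewrite inE; apply/negP => pk.
  by have : p \in S by [rewrite inE pL]; rewrite h inE.
have LXl l : (L \subset Xl l) = (S \subset [set (k, l)])%SET.
  apply/fintype.subsetP/fintype.subsetP => h p.
    rewrite !inE => /andP[/h]; rewrite inE => + /eqP pk; rewrite pk eqxx/= => /eqP <-.
    by case: p pk => ? ? /= ->.
  move=> pL; rewrite inE; case: (eqVneq p.1 k) => //= pk.
  by have := h p; rewrite !inE pL pk eqxx => /(_ isT)/eqP ->/=.
under eq_bigr do rewrite LXl LX; rewrite LX.
have [S0|S0] := eqVneq S finset.set0.
  rewrite S0 cards0 big1 ?addr0// => l _.
  by rewrite finset.sub0set subrr.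
rewrite add0r; under eq_bigr do rewrite subr0.
have [p pS] := set0Pn _ S0; have := pS; rewrite inE => /andP[pL /eqP pk].
case: leqP => S1.
  have SE : S = [set (k, p.2)]%SET.
    apply/esym/eqP; rewrite finset.eqEcard cards1 S1 andbT finset.sub1set.
    by rewrite -pk -surjective_pairing.
  rewrite (bigD1 p.2)//= SE subxx big1 ?addr0// => l lp.
  rewrite finset.sub1set inE xpair_eqE eqxx/=.
  by rewrite eq_sym (negbTE lp).
rewrite big1// => l _; case: (boolP (S \subset _)) => // /subset_leq_card.
by rewrite cards1 leqNgt S1.
Qed.

(** Injectivity of [fst] is a condition on each cell of [c] separately. The composition of thinnings
    is the form that acts factorwise on products over cells. *)
Lemma injective_thin c d x : Q setT x = x -> injective_event c d x =
  foldr (fun k => thin (c @^-1` [set k]) d) x (enum (color c)).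
Proof.
move=> Qx; set e := pair_coloring hA c d.
have -> : foldr (fun k => thin (c @^-1` [set k]) d) x (enum (color c)) =
  event (fun L : {set color e} =>
    all (fun k => #|[set p in L | p.1 == k]%SET| <= 1)%N (enum (color c))) x.
  elim: (enum _) => [|k s IH] /=; first by rewrite (eventT Qx).
  by rewrite IH thin_event (eventC hH hA hQ); apply: eq_bigl.
apply: eq_bigl => L; apply/imset_injP/allP => [h k _|h p q pL qL pq].
  apply/card_le1_eqP => p q; rewrite !inE => /andP[pL /eqP pk] /andP[qL /eqP qk].
  by apply: h => //; rewrite pk qk.
have /card_le1_eqP := h p.1 (mem_enum _ _).
by apply; rewrite !inE ?pL ?qL -?pq eqxx.
Qed.

(** The component of [x] with exactly one visited cell of [d]: the approximation of the first chaos
    at level [d]. *)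
Definition chaos d x : H :=
  \sum_(l : color d) (Q (d @^-1` [set l]) x - Q set0 x).

Let m0 : calA set0 := calA0 hA.
Let md d (l : color d) : calA (d @^-1` [set l]) := coloring_meas l.

Lemma dot_centered A B x : calA A -> calA B ->
  <[Q A x - Q set0 x, Q B x - Q set0 x]> = <[Q (A `&` B) x, x]> - <[Q set0 x, x]>.
Proof.
move=> cA cB; rewrite !(dotBl hH) !(dotBr hH) -!(Qsym hQ)// !(bp_comp hQ)//.
rewrite !set0I !setI0 setIC; ring.
Qed.

(** Each fine cell lies in a single coarse cell, and cross terms of disjoint cells cancel after
    centering; so the value depends on [d'] alone, which makes the net decreasing. *)
Lemma chaos_dot d d' x : coarser d d' -> <[chaos d x, chaos d' x]> =
  \sum_(m : color d') (<[Q (d' @^-1` [set m]) x, x]> - <[Q set0 x, x]>).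
Proof.
move=> [pi dd']; rewrite (dot_sumr hH); apply: eq_bigr => m _.
rewrite (dot_suml hH) (bigD1 (pi m))//= dot_centered// big1 ?addr0.
  congr (<[Q _ x, x]> - _); apply/setIidr => t /= tm.
  by rewrite dd' tm.
move=> l lm; rewrite dot_centered// (_ : _ `&` _ = set0) ?subrr//.
by apply/seteqP; split=> // t [/= tl tm]; rewrite dd' tm in tl; rewrite tl eqxx in lm.
Qed.

Lemma chaos_net d d' x : coarser d d' -> <[chaos d x, chaos d' x]> = sqn (chaos d' x).
Proof. by move=> dd'; rewrite !chaos_dot//; exact: coarser_refl. Qed.

Lemma Q_centered A B x : calA A -> calA B ->
  Q B (Q A x - Q set0 x) = Q (A `&` B) x - Q set0 x.
Proof. by move=> cA cB; rewrite (QB hH hQ)// !(bp_comp hQ)// setI0 setIC. Qed.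

Lemma first_chaos x : exists psi : H, [/\
  forall e : R, 0 < e -> exists d0, forall d, coarser d0 d -> sqn (chaos d x - psi) <= e,
  forall A B, calA A -> calA B -> A `&` B = set0 ->
    Q (A `|` B) psi = Q A psi + Q B psi
  & forall C, calA C -> Q C x = x -> Q C psi = psi].
Proof.
have [psi hpsi] := decreasing_net_cvg (x := fun d => chaos d x) hH
  (trivial_coloring hA) (coarser_dir hA) (fun d d' dd' => chaos_net x dd').
(* Both algebraic properties of [psi] are closed linear conditions, so they are checked on
   [chaos d x] for [d] fine enough. *)
have orth z d1 : (forall d, coarser d1 d -> <[chaos d x, z]> = 0) -> <[psi, z]> = 0.
  move=> h; apply: (dot_closed hH) => e /hpsi[d0 h0].
  have [d [d0d d1d]] := coarser_dir hA d0 d1.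
  by exists (chaos d x); [exact: h0|exact: h].
exists psi; split=> // [A B cA cB AB|C cC QC].
  have cAB : calA (A `|` B) by exact: calAU.
  apply: (dot_ext hH) => y; rewrite (dotDl hH) !(Qsym hQ)//.
  apply/eqP; rewrite -(dotDr hH) -subr_eq0 -(dotBr hH); apply/eqP.
  (* Beyond this partition each cell is either inside or outside [A], and likewise for [B], so
     additivity holds cell by cell. *)
  apply: (orth _ (pair_coloring hA (indicator_coloring hA cA) (indicator_coloring hA cB))).
  move=> d [pi hpi]; rewrite (dotBr hH) (dotDr hH) -!(Qsym hQ)// -(dotDl hH) -(dotBl hH).
  rewrite /chaos !(Q_sum hH hQ)// -big_split -sumrB/= (dot_suml hH).
  apply: big1 => l _; rewrite !Q_centered//.
  set D := d @^-1` [set l].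
  have Dsub A' (cA' : calA A') (b : bool) :
      (forall t, D t -> `[< A' t >] = b) -> D `&` A' = if b then D else set0.
    case: b => h; first by apply/setIidl => t /h/asboolP.
    by apply/seteqP; split=> // t [/h/negbT/asboolPn].
  have hA1 t : D t -> `[< A t >] = (pi l).1 by move=> <-; rewrite -hpi.
  have hB1 t : D t -> `[< B t >] = (pi l).2 by move=> <-; rewrite -hpi.
  have DA := Dsub _ cA _ hA1; have DB := Dsub _ cB _ hB1.
  have DAB : (D `&` A) `&` (D `&` B) = set0 by rewrite setIACA AB setI0.
  rewrite setIUr; move: DAB; rewrite DA DB.
  case: (pi l).1; case: (pi l).2; rewrite ?setIid ?setU0 ?set0U ?setUid => DAB;
    rewrite ?DAB ?subrr ?addr0 ?add0r ?subrr ?oppr0 ?(dot0l hH)//.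
apply: (dot_ext hH) => y; rewrite (Qsym hQ)//.
apply/eqP; rewrite -subr_eq0 -(dotBr hH); apply/eqP.
apply: (orth _ (trivial_coloring hA)) => d _.
rewrite (dotBr hH) -(Qsym hQ)//; apply/eqP; rewrite subr_eq0; apply/eqP; congr dot.
rewrite /chaos (Q_sum hH hQ)//; apply: eq_bigr => l _.
rewrite Q_centered//; congr (_ - _).
by rewrite -(bp_comp hQ)// QC.
Qed.

End thinning.

(** * The Hilbert space of square integrable functions *)

Section square_integrable.
Context (d : measure_display) (Omega : measurableType d) (R : realType)
  (P : probability Omega R).
Local Notation sqint := (Lfun P 2%:E).
Implicit Types (f g h : Omega -> R).

Lemma sqint_meas f : f \in sqint -> measurable_fun setT f.
Proof. by move/sub_Lfun_mfun; rewrite inE. Qed.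

Lemma sqint_lin a f g : f \in sqint -> g \in sqint -> a \*: f \+ g \in sqint.
Proof.
move=> f2 g2; have [_ h] := @Lfun_submod_closed _ _ _ P 2%:E (lee1n 2).
exact: (h _ _ _ f2 g2).
Qed.

Lemma sqint0 : cst 0 \in sqint. Proof. exact: Lfun_cst. Qed.

Lemma sqintB f g : f \in sqint -> g \in sqint -> f \- g \in sqint.
Proof.
move=> f2 g2; have -> : f \- g = (-1) \*: g \+ f; last exact: sqint_lin.
by apply/funext => x /=; rewrite scaleN1r addrC.
Qed.

Lemma integrable_prod f g : f \in sqint -> g \in sqint ->
  P.-integrable setT (EFin \o (f \* g)).
Proof. by move=> f2 g2; apply/Lfun1_integrable/Lfun2_mul_Lfun1. Qed.

Lemma sqintP f : measurable_fun setT f ->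
  (\int[P]_x ((f x) ^+ 2)%:E < +oo)%E -> f \in sqint.
Proof.
move=> mf fi; apply/andP; split; rewrite inE//=.
rewrite /finite_norm unlock /Lnorm; apply: poweR_lty.
by under eq_integral => x _ do rewrite /= powR_mulrn// -normrX ger0_norm ?sqr_ge0//.
Qed.

Definition dotf f g : R := \int[P]_x (f x * g x).

Lemma dotfC f g : dotf f g = dotf g f.
Proof. by apply: eq_Rintegral => x _; rewrite mulrC. Qed.

Lemma dotf_linl a f g h : f \in sqint -> g \in sqint -> h \in sqint ->
  dotf (a \*: f \+ g) h = a * dotf f h + dotf g h.
Proof.
move=> f2 g2 h2; rewrite /dotf -RintegralZl//; last exact: integrable_prod.
rewrite -RintegralD//; last 2 first.
- have := integrableZl measurableT a (integrable_prod f2 h2).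
  by apply: eq_integrable => // x _ /=; rewrite EFinM.
- exact: integrable_prod.
by apply: eq_Rintegral => x _ /=; rewrite mulrDl mulrA.
Qed.

Lemma dotf_ge0 f : 0 <= dotf f f.
Proof. by apply: Rintegral_ge0 => x _; rewrite -expr2 sqr_ge0. Qed.

Lemma dotfE f : f \in sqint -> (\int[P]_x ((f x) ^+ 2)%:E = (dotf f f)%:E)%E.
Proof.
move=> f2; rewrite /dotf /Rintegral fineK//.
exact/integrable_fin_num/integrable_prod.
Qed.

Lemma dotf_eq0 f : f \in sqint -> dotf f f = 0 -> {ae P, forall x, f x = 0}.
Proof.
move=> f2 f0; have := dotfE f2; rewrite f0 => h.
have /measurable_EFinP mf : measurable_fun setT (fun x => f x ^+ 2).
  exact/measurable_funX/sqint_meas.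
have [h1 _] := ae_eq_integral_abs P measurableT mf.
have /h1 : (\int[P]_x `|((f x) ^+ 2)%:E| = 0)%E.
  by under eq_integral do rewrite gee0_abs ?lee_fin ?sqr_ge0//.
apply: filterS => x /(_ I) /= [] /eqP; rewrite sqrf_eq0 => /eqP; exact.
Qed.

Lemma ae_dotf f g h : {ae P, forall x, f x = g x} ->
  measurable_fun setT f -> measurable_fun setT g -> measurable_fun setT h ->
  dotf f h = dotf g h.
Proof.
move=> fg mf mg mh; rewrite /dotf /Rintegral; congr fine.
apply: ae_eq_integral => //; try exact/measurable_EFinP/measurable_funM.
by apply: filterS fg => x -> _.
Qed.

(* A class modulo null sets is represented by the linear functional
   [g |-> E[f g]] on square integrable functions. *)
Definition functional f : (Omega -> R) -> R^o :=
  fun g => if g \in sqint then dotf f g else 0.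

Definition L2_pred : {pred ((Omega -> R) -> R^o)} :=
  mem [set phi | exists2 f, f \in sqint & phi = functional f].

Lemma L2_submod : submod_closed L2_pred.
Proof.
split.
  rewrite inE /=; exists (cst 0); first exact: sqint0.
  apply/funext => g; rewrite /functional; case: ifP => // g2.
  rewrite /dotf; under eq_Rintegral do rewrite mul0r.
  by rewrite Rintegral_cst// mul0r.
move=> a u v; rewrite !inE /= => -[f f2 ->] [g g2 ->].
exists (a \*: f \+ g); first exact: sqint_lin.
apply/funext => h; rewrite /functional !fctE; case: ifP => h2.
  by rewrite dotf_linl.
by rewrite scaler0 addr0.
Qed.

End square_integrable.

HB.instance Definition _ (d : measure_display) (Omega : measurableType d)
    (R : realType) (P : probability Omega R) :=
  GRing.isSubmodClosed.Build R ((Omega -> R) -> R^o) (L2_pred P) (L2_submod P).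

Record L2 (d : measure_display) (Omega : measurableType d) (R : realType)
    (P : probability Omega R) :=
  MkL2 { L2val : (Omega -> R) -> R^o ; _ : L2val \in L2_pred P }.

HB.instance Definition _ (d : measure_display) (Omega : measurableType d)
    (R : realType) (P : probability Omega R) := [isSub for @L2val d Omega R P].
HB.instance Definition _ (d : measure_display) (Omega : measurableType d)
    (R : realType) (P : probability Omega R) := [Choice of L2 P by <:].
HB.instance Definition _ (d : measure_display) (Omega : measurableType d)
    (R : realType) (P : probability Omega R) :=
  [SubChoice_isSubLmodule of L2 P by <:].

Section L2_hilbert.
Context (d : measure_display) (Omega : measurableType d) (R : realType)
  (P : probability Omega R).
Local Notation sqint := (Lfun P 2%:E).
Implicit Types (f g h : Omega -> R) (x y : L2 P).

(** Meaningful as the class of [f] only for square integrable [f]; 0 is a default value. *)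
Definition cls f : L2 P := insubd (0 : L2 P) (functional P f).

Lemma cls_val f : f \in sqint -> val (cls f) = functional P f.
Proof. by move=> f2; rewrite insubdK// inE; exists f. Qed.

Lemma rep_exists x : exists2 f, f \in sqint & val x = functional P f.
Proof. by have := valP x; rewrite inE. Qed.

Definition rep x : Omega -> R := sval (cid2 (rep_exists x)).

Lemma rep_sqint x : rep x \in sqint.
Proof. by rewrite /rep; case: cid2. Qed.

Lemma repK x : cls (rep x) = x.
Proof. by apply: val_inj; rewrite cls_val ?rep_sqint// /rep; case: cid2. Qed.

Definition L2dot x y : R := dotf P (rep x) (rep y).

Lemma rep_cls f g : f \in sqint -> g \in sqint ->
  dotf P (rep (cls f)) g = dotf P f g.
Proof.
move=> f2 g2; have := congr1 (fun u => val u g) (repK (cls f)).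
by rewrite !cls_val ?rep_sqint// /functional g2.
Qed.

Lemma dot_cls f g : f \in sqint -> g \in sqint -> L2dot (cls f) (cls g) = dotf P f g.
Proof. by move=> f2 g2; rewrite /L2dot rep_cls ?rep_sqint// dotfC rep_cls// dotfC. Qed.

Lemma cls_lin a f g : f \in sqint -> g \in sqint ->
  cls (a \*: f \+ g) = a *: cls f + cls g.
Proof.
move=> f2 g2; apply: val_inj; rewrite cls_val ?sqint_lin//.
transitivity (a *: val (cls f) + val (cls g)); last by rewrite -linearP.
rewrite !cls_val//.
apply/funext => h; rewrite /functional !fctE; case: ifP => h2.
  by rewrite dotf_linl.
by rewrite scaler0 addr0.
Qed.

Lemma cls_ae f g : f \in sqint -> g \in sqint ->
  {ae P, forall w, f w = g w} -> cls f = cls g.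
Proof.
move=> f2 g2 fg; apply: val_inj; rewrite !cls_val//; apply/funext => h.
rewrite /functional; case: ifP => // h2.
exact: (ae_dotf fg (sqint_meas f2) (sqint_meas g2) (sqint_meas h2)).
Qed.

Lemma cls0 : cls (cst 0) = 0.
Proof.
have := cls_lin 0 (sqint0 P) (sqint0 P).
rewrite scale0r add0r (_ : 0 \*: _ \+ _ = cst 0); last first.
  by apply/funext => w /=; rewrite scale0r addr0.
have := cls_lin (-1) (sqint0 P) (sqint0 P).
rewrite (_ : _ \*: _ \+ _ = cst 0); last first.
  by apply/funext => w /=; rewrite scaler0 addr0.
by rewrite scaleN1r addNr.
Qed.

Lemma clsB f g : f \in sqint -> g \in sqint -> cls (f \- g) = cls f - cls g.
Proof.
move=> f2 g2; have -> : f \- g = (-1) \*: g \+ f.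
  by apply/funext => w /=; rewrite scaleN1r addrC.
by rewrite cls_lin// scaleN1r addrC.
Qed.

Lemma cls_inj_ae f g : f \in sqint -> g \in sqint ->
  cls f = cls g -> {ae P, forall w, f w = g w}.
Proof.
move=> f2 g2 fg; have : L2dot (cls (f \- g)) (cls (f \- g)) = 0.
  by rewrite clsB// fg subrr -cls0 dot_cls ?sqint0// /dotf;
    under eq_Rintegral do rewrite mul0r; rewrite Rintegral_cst// mul0r.
rewrite dot_cls ?sqintB// => /(dotf_eq0 (sqintB f2 g2)).
by apply: filterS => w /eqP; rewrite subr_eq0 => /eqP.
Qed.

Lemma rep_cls_ae f : f \in sqint -> {ae P, forall w, rep (cls f) w = f w}.
Proof. by move=> f2; apply: cls_inj_ae; rewrite ?rep_sqint ?repK. Qed.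

Lemma L2dotC x y : L2dot x y = L2dot y x. Proof. exact: dotfC. Qed.

Lemma L2dotP a x y z : L2dot (a *: x + y) z = a * L2dot x z + L2dot y z.
Proof.
rewrite -(repK x) -(repK y) -(repK z) -cls_lin ?rep_sqint//.
by rewrite !dot_cls ?sqint_lin ?rep_sqint// dotf_linl ?rep_sqint.
Qed.

Lemma L2dot_ge0 x : 0 <= L2dot x x. Proof. exact: dotf_ge0. Qed.

Lemma L2dot_eq0 x : L2dot x x = 0 -> x = 0.
Proof.
rewrite -{3}(repK x) -cls0 => /(dotf_eq0 (rep_sqint x)) x0.
by apply: cls_ae => //; [exact: rep_sqint|exact: sqint0].
Qed.

Lemma L2_inner : inner_product L2dot.
Proof.
split; [exact: L2dotC| |move=> a x y|exact: L2dot_ge0|exact: L2dot_eq0].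
  by move=> x y z; have := L2dotP 1 x y z; rewrite scale1r mul1r.
have L0 : L2dot 0 y = 0.
  by have := L2dotP (-1) 0 0 y; rewrite scaler0 addr0 mulN1r addNr.
by rewrite -[a *: x]addr0 L2dotP L0 addr0.
Qed.

Definition fmeas (G : set_system Omega) f : Prop :=
  forall B : set R, measurable B -> G (f @^-1` B).

(** The existential is essential: the chosen representative [rep x] may fail to be
    [G]-measurable. *)
Definition Lsub (G : set_system Omega) : set (L2 P) :=
  [set x | exists2 f, f \in sqint /\ fmeas G f & x = cls f].

Lemma fmeasP (G : set_system Omega) f : sigma_algebra setT G ->
  fmeas G f <-> measurable_fun (setT : set (g_sigma_algebraType G)) f.
Proof.
move=> sG; split=> [h _ B mB|h B mB].
  by rewrite setTI /measurable /= sigma_algebra_id//; exact: h.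
have := h measurableT _ mB; rewrite setTI /measurable /= sigma_algebra_id//.
Qed.

(** Bounds first moments by second moments without square roots; the weight [p] is adapted to the
    expected size of [v]. *)
Lemma Rabs_amgm (v p : R) : 0 < p -> `|v| <= (p + p^-1 * v ^+ 2) / 2.
Proof.
move=> p0; rewrite -(real_normK (num_real v)); set a := `|v|.
rewrite -subr_ge0 -(pmulr_rge0 _ (mulr_gt0 (ltr0Sn R 1) p0)).
suff -> : 2%:R * p * ((p + p^-1 * a ^+ 2) / 2 - a) = (p - a) ^+ 2 by exact: sqr_ge0.
by field; rewrite gt_eqF.
Qed.

End L2_hilbert.

(** * Completeness of L2 and of its subspaces of measurable functions *)

Section riesz_fischer.
Context (d : measure_display) (Omega : measurableType d) (R : realType)
  (P : probability Omega R).
Local Notation sqint := (Lfun P 2%:E).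
Implicit Types (f g h : Omega -> R) (x y : L2 P).

Lemma einfs_le (u : (\bar R)^nat) (c : \bar R) :
  (forall n, (u n <= c)%E) -> (limn_einf u <= c)%E.
Proof.
move=> h; rewrite limn_einf_lim; apply: lime_le; first exact: is_cvg_einfs.
apply: nearW => n; apply: le_trans (h n); apply: ereal_inf_lbound.
by exists n => //=.
Qed.

Lemma fast_cauchy_ae_cvg (u : nat -> Omega -> R) :
  (forall n, u n \in sqint) ->
  (forall k l, (k <= l)%N -> dotf P (u l \- u k) (u l \- u k) <= 4^-1 ^+ k) ->
  {ae P, forall w, cvgn (u ^~ w)}.
Proof.
move=> u2 hu; pose v k w := `|u k.+1 w - u k w|.
have mv k : measurable_fun setT (v k).
  apply: measurableT_comp => //.
  by apply: measurable_funB; exact: (sqint_meas (u2 _)).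
have mEv k : measurable_fun setT (EFin \o v k) by exact/measurable_EFinP.
(* With weight [2^-k] the bound is [(2^-k + 2^k 4^-k) / 2 = 2^-k], written in the shape summed by
   [epsilon_trick0]. *)
have vint k : (\int[P]_w (v k w)%:E <= (2 / (2 ^ k.+1)%:R)%:E)%E.
  have B2 := sqintB (u2 k.+1) (u2 k).
  have p0 : 0 < 2^-1 ^+ k :> R by rewrite exprn_gt0// invr_gt0.
  apply: (@le_trans _ _ (\int[P]_w ((2^-1 ^+ k + 2 ^+ k * (u k.+1 w - u k w) ^+ 2) / 2)%:E)%E).
    apply: ge0_le_integral => //.
    - by move=> w _; rewrite lee_fin normr_ge0.
    - exact: mEv.
    - apply/measurable_EFinP/measurable_funM => //; apply: measurable_funD => //.
      apply: measurable_funM => //; apply: measurable_funX.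
      exact: sqint_meas B2.
    - move=> w _ /=; rewrite lee_fin; apply: le_trans (Rabs_amgm _ p0) _.
      by rewrite -exprVn invrK.
  have -> : (\int[P]_w ((2^-1 ^+ k + 2 ^+ k * (u k.+1 w - u k w) ^+ 2) / 2)%:E =
     (2^-1 ^+ k / 2)%:E + (2 ^+ k / 2)%:E * (dotf P (u k.+1 \- u k) (u k.+1 \- u k))%:E)%E.
    transitivity (\int[P]_w ((2^-1 ^+ k / 2)%:E +
        (2 ^+ k / 2)%:E * ((u k.+1 w - u k w) ^+ 2)%:E))%E.
      by apply: eq_integral => w _; rewrite mulrDl EFinD mulrAC EFinM.
    rewrite ge0_integralD//; last 2 first.
    - by move=> w _; rewrite -EFinM lee_fin mulr_ge0 ?sqr_ge0 ?divr_ge0 ?exprn_ge0.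
    - apply: emeasurable_funM; first exact: measurable_cst.
      apply/measurable_EFinP/measurable_funX.
      exact: sqint_meas B2.
    congr (_ + _)%E.
      rewrite integral_cst// -[RHS]mule1; congr (_ * _)%E.
      exact: probability_setT.
    rewrite ge0_integralZl//; last 2 first.
    - apply/measurable_EFinP/measurable_funX; exact: sqint_meas B2.
    - by move=> w _; rewrite lee_fin sqr_ge0.
    by rewrite -dotfE.
  rewrite -EFinM -EFinD lee_fin.
  have := hu k k.+1 (leqnSn k); set D := dotf _ _ _ => hD.
  rewrite natrX exprS invfM mulrA mulfV// mul1r -exprVn.
  have e1 : 2 ^+ k * 2^-1 ^+ k = 1 :> R by rewrite -exprMn mulfV// expr1n.
  have := ler_wpM2l (exprn_ge0 k (ler0n R 2)) hD.
  rewrite (_ : 4^-1 ^+ k = 2^-1 ^+ k * 2^-1 ^+ k) ?mulrA ?e1 ?mul1r; last first.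
    by rewrite -exprMn; congr (_ ^+ k); field.
  rewrite [2 ^+ k / 2 * D]mulrAC; move: (2 ^+ k * D) (2^-1 ^+ k : R) => a b; lra.
have Sfin : (\int[P]_w (\sum_(k <oo) (v k w)%:E) < +oo)%E.
  rewrite integral_nneseries//; last by move=> n w _; rewrite lee_fin normr_ge0.
  apply: (@le_lt_trans _ _ 2%:E); last exact: ltry.
  apply: le_trans (epsilon_trick0 xpredT (ler0n R 2)).
  apply: lee_nneseries => k _; last exact: vint.
  by move=> _; apply: integral_ge0 => w _; rewrite lee_fin normr_ge0.
have Sint : P.-integrable setT (fun w => \sum_(k <oo) (v k w)%:E)%E.
  apply/integrableP; split.
    apply: ge0_emeasurable_sum => [k w _ _|k _]; last exact: mEv.
    by rewrite lee_fin normr_ge0.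
  rewrite (eq_integral (fun w => \sum_(k <oo) (v k w)%:E)%E)// => w _.
  by rewrite gee0_abs//; apply: nneseries_ge0 => k _ _; rewrite lee_fin normr_ge0.
have := integrable_ae measurableT Sint; apply: filterS => w /(_ I) wfin.
have cv : cvgn [normed series (fun k => u k.+1 w - u k w)].
  apply: nondecreasing_is_cvgn; first by apply: nondecreasing_series => k _ _ /=.
  exists (fine (\sum_(k <oo) (v k w)%:E)%E) => _ [n _ <-].
  rewrite -lee_fin fineK// /series /= -sumEFin.
  by apply: nneseries_lim_ge => k _ _; rewrite lee_fin.
have := normed_cvg cv; rewrite /series /=.
have -> : (fun n => \sum_(0 <= k < n) (u k.+1 w - u k w)) = (fun n => u n w - u 0%N w).
  by apply/funext => n; rewrite telescope_sumr.
move=> cu; have -> : u ^~ w = cst (u 0%N w) + (fun n => u n w - u 0%N w).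
  by apply/funext => n; rewrite fctE subrKC.
by apply: is_cvgD => //; exact: is_cvg_cst.
Qed.

Lemma riesz_fischer (G : set_system Omega) (x_ : nat -> L2 P) :
  sigma_algebra setT G -> G `<=` measurable ->
  (forall n, Lsub G (x_ n)) -> l2cauchy (@L2dot _ _ _ P) x_ ->
  exists2 y, Lsub G y & l2cvg (@L2dot _ _ _ P) x_ y.
Proof.
move=> sG GM xG xc.
have /choice[f hf] : forall n, exists f, [/\ f \in sqint, fmeas G f & x_ n = cls P f].
  by move=> n; have [f [? ?] ?] := xG n; exists f.
have e0 k : 0 < 4^-1 ^+ k :> R by rewrite exprn_gt0// invr_gt0.
have /choice[s hs] : forall k, exists N, forall n m, (N <= n)%N -> (N <= m)%N ->
    L2dot (x_ n - x_ m) (x_ n - x_ m) <= 4^-1 ^+ k by move=> k; exact: xc.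
(* The maximum makes every index [t l] with [k <= l] admissible for the tolerance [4^-k]. *)
pose t k := \max_(j < k.+1) s j.
have st k l : (k <= l)%N -> (s k <= t l)%N.
  by move=> kl; rewrite -ltnS in kl; exact: (leq_bigmax (Ordinal kl)).
pose u k := f (t k).
have u2 k : u k \in sqint by case: (hf (t k)).
have uG k : fmeas G (u k) by case: (hf (t k)).
have ux k : x_ (t k) = cls P (u k) by case: (hf (t k)).
have hu k l : (k <= l)%N -> dotf P (u l \- u k) (u l \- u k) <= 4^-1 ^+ k.
  move=> kl; rewrite -dot_cls ?sqintB// clsB// -!ux.
  by apply: hs; [exact: st|exact: st].
have aec := fast_cauchy_ae_cvg u2 hu.
(* The upper limit is [G]-measurable everywhere, even where the sequence diverges. *)
pose h w := fine (limn_esup (fun k => (u k w)%:E)).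
have hG : fmeas G h.
  apply/(fmeasP _ sG); apply: measurableT_comp; first exact: fine_measurable.
  apply: measurable_fun_limn_esup => k; apply/measurable_EFinP.
  by apply/(fmeasP _ sG).
have mh : measurable_fun setT h by move=> _ B mB; rewrite setTI; exact/GM/hG.
have uh : {ae P, forall w, u k w @[k --> \oo] --> h w}.
  apply: filterS aec => w /cvg_ex[l ul]; rewrite /h.
  have /cvg_limn_einf_sup[_ ->] : (u k w)%:E @[k --> \oo] --> l%:E.
    by apply: cvg_EFin => //; exact: nearW.
  exact: ul.
(* Fatou's lemma passes the Cauchy bound to the limit. *)
have hk k : (\int[P]_w ((h w - u k w) ^+ 2)%:E <= (4^-1 ^+ k)%:E)%E.
  pose v l w := ((u (l + k)%N w - u k w) ^+ 2)%:E.
  have mv l : measurable_fun setT (v l).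
    apply/measurable_EFinP/measurable_funX/measurable_funB.
      exact: sqint_meas (u2 _).
    exact: sqint_meas (u2 _).
  have v0 l w : (0 <= v l w)%E by rewrite lee_fin sqr_ge0.
  have -> : (\int[P]_w ((h w - u k w) ^+ 2)%:E = \int[P]_w limn_einf (v ^~ w))%E.
    apply: ae_eq_integral => //.
    - apply/measurable_EFinP/measurable_funX/measurable_funB => //.
      exact: sqint_meas (u2 _).
    - apply: measurableT_comp => //.
      by apply: measurable_fun_limn_esup => l; apply: measurableT_comp.
    apply: filterS uh => w uw _.
    have /cvg_limn_einf_sup[-> //] : v l w @[l --> \oo] --> ((h w - u k w) ^+ 2)%:E.
    apply: cvg_EFin; first exact: nearW.
    have c1 : (fun l => u (l + k)%N w) @ \oo --> h w.
      by have := uw; rewrite -(cvg_shiftn k).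
    rewrite expr2 (_ : fine \o _ = (fun l => (u (l + k)%N w - u k w) * (u (l + k)%N w - u k w))).
      by apply: cvgM; apply: cvgB => //; exact: cvg_cst.
    by apply/funext => l /=; rewrite expr2.
  apply: le_trans (fatou _ _ _ _) _ => //.
  apply: einfs_le => l; rewrite dotfE ?sqintB// lee_fin; apply: hu.
  exact: leq_addl.
have hk2 k : h \- u k \in sqint.
  apply: sqintP; first by apply: measurable_funB => //; exact: sqint_meas (u2 _).
  by apply: le_lt_trans (hk k) _; exact: ltry.
have h2 : h \in sqint.
  have -> : h = 1 \*: (h \- u 0%N) \+ u 0%N.
    by apply/funext => w /=; rewrite scale1r subrK.
  exact: sqint_lin.
exists (cls P h); first by exists h.
move=> e ep; have a0 : 0 <= 4^-1 :> R by rewrite invr_ge0.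
have a1 : 4^-1 < 1 :> R by rewrite invf_lt1 ?ltr1n.
have [k hke] := geometric_small 4 a0 a1 ep.
exists (t k) => n tn; apply: le_trans (sqn_addB (L2_inner P) _ (x_ (t k)) _) _.
have h1 : L2dot (x_ n - x_ (t k)) (x_ n - x_ (t k)) <= 4^-1 ^+ k.
  by apply: hs; [apply: leq_trans tn|]; exact: st.
have h3 : L2dot (x_ (t k) - cls P h) (x_ (t k) - cls P h) <= 4^-1 ^+ k.
  rewrite (sqnBC (L2_inner P)) ux -clsB// dot_cls// -lee_fin -dotfE//; exact: hk.
have := hke; lra.
Qed.

End riesz_fischer.

(** * Conditional expectation and independence *)

Section conditional_expectation.
Context (d : measure_display) (Omega : measurableType d) (R : realType)
  (P : probability Omega R).
Local Notation sqint := (Lfun P 2%:E).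
Local Notation cls := (cls P).
Local Notation L2 := (L2 P).
Local Notation dot := (@L2dot _ _ _ P).
Local Notation Lsub G := (@Lsub _ _ _ P G).
Local Notation sub_sigma_field := (sub_sigma_field P).
Local Notation sqn x := (dot x x).
Implicit Types (f g h : Omega -> R) (x y : L2) (G : set_system Omega).

Lemma L2_hilbert : hilbert dot.
Proof.
split=> [|x xc]; first exact: L2_inner.
have sM : sigma_algebra setT (@measurable d Omega).
  split=> [|A mA|F mF]; [exact: measurable0| |exact: bigcupT_measurable].
  by rewrite setTD; exact: measurableC.
have [||y _ xy] := riesz_fischer sM _ _ xc => //; last by exists y.
move=> n; exists (rep (x n)); last by rewrite repK.
split; first exact: rep_sqint.
move=> B mB; rewrite -[X in measurable X]setTI.
exact: (sqint_meas (rep_sqint (x n))).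
Qed.
Let hH := L2_hilbert.

Lemma Lsub0 G : sigma_algebra setT G -> Lsub G 0.
Proof.
move=> sG; exists (cst 0); last by rewrite cls0.
by split; [exact: sqint0|apply/(fmeasP _ sG)].
Qed.

Lemma Lsub_lin G a x y : sigma_algebra setT G -> Lsub G x -> Lsub G y ->
  Lsub G (a *: x + y).
Proof.
move=> sG [f [f2 fG] ->] [g [g2 gG] ->]; exists (a \*: f \+ g).
  split; first exact: sqint_lin.
  apply/(fmeasP _ sG); apply: measurable_funD; last by apply/(fmeasP _ sG).
  by apply: measurable_funM => //; apply/(fmeasP _ sG).
by rewrite cls_lin.
Qed.

Lemma LsubD G x y : sigma_algebra setT G -> Lsub G x -> Lsub G y -> Lsub G (x + y).
Proof. by move=> sG xG yG; rewrite -[x]scale1r; exact: Lsub_lin. Qed.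

Lemma LsubB G x y : sigma_algebra setT G -> Lsub G x -> Lsub G y -> Lsub G (x - y).
Proof. by move=> sG xG yG; rewrite addrC -scaleN1r; exact: Lsub_lin. Qed.

Lemma Lsub_sum G I (r : seq I) (Pr : pred I) (F : I -> L2) : sigma_algebra setT G ->
  (forall i, Lsub G (F i)) -> Lsub G (\sum_(i <- r | Pr i) F i).
Proof.
by move=> sG FG; apply: big_ind => [|x y|i _]; [exact: Lsub0|exact: LsubD|exact: FG].
Qed.

Lemma Lsub_mono G G' x : G `<=` G' -> Lsub G x -> Lsub G' x.
Proof. by move=> GG' [f [f2 fG] ->]; exists f => //; split=> // B /fG /GG'. Qed.

Definition condE_spec G (Q : L2 -> L2) : Prop :=
  forall x, Lsub G (Q x) /\ forall s, Lsub G s -> dot (x - Q x) s = 0.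

(** The default [id] keeps the operator total in [G]; for a sub-sigma-field [orthogonal_projection]
    rules that branch out. *)
Definition condE G : L2 -> L2 :=
  if pselect (exists Q, condE_spec G Q) is left h then sval (cid h) else id.

Lemma condEP G : sub_sigma_field G -> condE_spec G (condE G).
Proof.
move=> [sG GM _]; rewrite /condE; case: pselect => [h|noQ]; first by case: cid.
have [|a x y|x xG xc|Q hQ] := orthogonal_projection hH (S := Lsub G).
- exact: Lsub0.
- exact: Lsub_lin.
- exact: riesz_fischer xc.
- by case: noQ; exists Q.
Qed.

Section condE_theory.
Context (G : set_system Omega) (hG : sub_sigma_field G).
Let sG : sigma_algebra setT G. Proof. by case: hG. Qed.

Lemma condE_Lsub x : Lsub G (condE G x). Proof. by case: (condEP hG x). Qed.

Lemma condE_dot x s : Lsub G s -> dot (condE G x) s = dot x s.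
Proof.
case: (condEP hG x) => _ h /h /eqP; rewrite (dotBl hH) subr_eq0 => /eqP ->//.
Qed.

Lemma condE_sym x y : dot (condE G x) y = dot x (condE G y).
Proof.
rewrite -[RHS](condE_dot _ (condE_Lsub y)) (dotC hH) -[RHS](dotC hH).
by rewrite -(condE_dot _ (condE_Lsub x)).
Qed.

Lemma condE_unique x y : Lsub G y -> (forall s, Lsub G s -> dot x s = dot y s) ->
  condE G x = y.
Proof.
move=> yG xy; apply/eqP; rewrite -subr_eq0; apply/eqP/(dot_eq0 hH).
have xyG : Lsub G (condE G x - y) by apply: LsubB => //; exact: condE_Lsub.
by rewrite (dotBl hH) condE_dot// xy// subrr.
Qed.

Lemma condE_id x : Lsub G x -> condE G x = x.
Proof. by move=> xG; exact: condE_unique. Qed.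

End condE_theory.

Definition ind (E : set Omega) : L2 := cls \1_E.

Lemma ind_sqint (E : set Omega) : measurable E -> (\1_E : Omega -> R) \in sqint.
Proof.
move=> mE; apply: sqintP; first exact: measurable_indic.
rewrite (eq_integral (fun w => (\1_E w)%:E)) => [|w _].
  by rewrite integral_indic// setIT (le_lt_trans (probability_le1 P mE))// ltry.
by rewrite indicE; case: (w \in E); rewrite ?expr1n ?expr0n.
Qed.

Lemma dot_ind f (E : set Omega) : f \in sqint -> measurable E ->
  ((dot (cls f) (ind E))%:E = \int[P]_(w in E) (f w)%:E)%E.
Proof.
move=> f2 mE; have E2 := ind_sqint mE; rewrite dot_cls// /dotf /Rintegral fineK.
  rewrite [RHS]integral_mkcond; apply: eq_integral => w _ /=.
  by rewrite patchE indicE; case: (w \in E); rewrite ?mulr1 ?mulr0.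
exact/integrable_fin_num/integrable_prod.
Qed.

Lemma fmeas_indic G (E : set Omega) : sigma_algebra setT G -> G E ->
  fmeas G (\1_E : Omega -> R).
Proof.
move=> sG GE; apply/(fmeasP _ sG); apply: measurable_indic.
by rewrite /measurable /= sigma_algebra_id.
Qed.

Lemma Lsub_ind G (E : set Omega) : sub_sigma_field G -> G E -> Lsub G (ind E).
Proof.
move=> [sG GM _] GE; exists (\1_E) => //.
by split; [exact/ind_sqint/GM|exact: fmeas_indic].
Qed.

Lemma sub_sigma_field_generated (C : set_system Omega) : C `<=` measurable ->
  sub_sigma_field (generated P C).
Proof.
move=> CM; split; first exact: smallest_sigma_algebra.
  apply: smallest_sub; first exact: sigma_algebra_measurable.
  by move=> E [/CM//|[]].
by move=> N hN; apply: sub_sigma_algebra; right.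
Qed.

Lemma indC (E : set Omega) : measurable E -> ind (~` E) = ind setT - ind E.
Proof.
move=> mE; rewrite /ind -clsB ?ind_sqint//; congr (cls _); apply/funext => w /=.
by rewrite !indicE in_setC in_setT; case: (w \in E); rewrite ?subrr ?subr0.
Qed.

Lemma ind_null (E : set Omega) : measurable E -> P E = 0%E -> ind E = 0.
Proof.
move=> mE E0; rewrite -(cls0 P); apply: cls_ae; [exact: ind_sqint|exact: sqint0|].
exists E; split=> // w /= h; apply: contrapT => nE; apply: h.
by rewrite indicE memNset.
Qed.

(** A pi-lambda argument: events on which [x] integrates to zero form a lambda-system, and [C]
    together with the null sets is stable under intersection. *)
Lemma Lsub_eq0 (C : set_system Omega) x : C `<=` measurable -> setI_closed C ->
  C setT -> Lsub (generated P C) x -> (forall E, C E -> dot x (ind E) = 0) -> x = 0.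
Proof.
move=> CM CI CT [f [f2 fG] ->] fC.
have [sG GM NG] := sub_sigma_field_generated CM.
pose D := [set E | measurable E /\ dot (cls f) (ind E) = 0].
have fi : P.-integrable setT (EFin \o f).
  apply/Lfun1_integrable; apply: Lfun_subset12 f2.
  exact: fin_num_measure.
have GD : generated P C `<=` D.
  apply: lambda_system_subset => //.
  - move=> E1 E2 [C1|[m1 N1]] [C2|[m2 N2]].
    + by left; exact: CI.
    + right; split; first by apply: measurableI => //; exact: CM.
      apply: (subset_measure0 (B := E2)) => //; exact/measurableI/m2/CM.
    + right; split; first by apply: measurableI => //; exact: CM.
      by apply: (subset_measure0 (B := E1)) => //; apply: measurableI => //; exact: CM.
    + right; split; first exact: measurableI.
      by apply: (subset_measure0 (B := E1)) => //; exact: measurableI.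
  - apply/dynkin_lambda_system; split.
    + by split => //; exact: fC.
    + move=> E [mE E0]; split; first exact: measurableC.
      by rewrite indC// (dotBr hH) fC// E0 subrr.
    + move=> F tF DF; have mF n : measurable (F n) by case: (DF n).
      split; first exact: bigcupT_measurable.
      apply: EFin_inj; rewrite dot_ind//; last exact: bigcupT_measurable.
      rewrite integral_bigcup//; last first.
        by apply: integrableS fi => //; exact: bigcupT_measurable.
      by apply: eseries0 => n _ _; rewrite -dot_ind//; case: (DF n) => _ ->.
  - move=> E [CE|[mE N0]]; split=> //; [exact: CM|exact: fC|].
    by rewrite ind_null// (dot0r hH).
(* Testing on the event where [f] is nonnegative and on its complement gives [E|f| = 0]. *)
pose E := f @^-1` [set` `[0, +oo[].
have GE : generated P C E by apply: fG; exact: measurable_itv.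
have EP w : E w = (0 <= f w) :> Prop by rewrite /E /= in_itv /= andbT.
have mE : measurable E by exact: GM.
have nE : measurable (~` E) by exact: measurableC.
have [_ fE] := GD _ GE.
have [_ fCE] : D (~` E) by apply: GD; case: sG => _ + _ => /(_ _ GE); rewrite setTD.
have abs0 : (\int[P]_w `|(f w)%:E| = 0)%E.
  have : dot (cls f) (ind E - ind (~` E)) = 0 by rewrite (dotBr hH) fE fCE subrr.
  rewrite -clsB ?ind_sqint// dot_cls ?sqintB ?ind_sqint// /dotf /Rintegral.
  under eq_integral => w _.
    rewrite (_ : f w * _ = `|f w|); first by over.
    rewrite /= !indicE in_setC; case: (boolP (w \in E)) => /=.
      by rewrite inE EP subr0 mulr1 => w0; rewrite ger0_norm.
    by rewrite notin_setE EP sub0r mulrN1 => /negP; rewrite -ltNge => /ltr0_norm ->.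
  have := integrable_fin_num measurableT (integrable_abse fi).
  by move=> /fineK {2}<- /= ->.
have [h1 _] := ae_eq_integral_abs P measurableT (measurable_int P fi).
rewrite -cls0; apply: cls_ae => //; first exact: sqint0.
by apply: filterS (h1 abs0) => w /(_ I) [].
Qed.

Lemma Lsub_orth G x z : sub_sigma_field G -> Lsub G x ->
  (forall E, G E -> dot z (ind E) = 0) -> dot z x = 0.
Proof.
move=> hG xG zE; rewrite -(condE_dot hG _ xG) (_ : condE G z = 0) ?(dot0l hH)//.
have [sG GM _] := hG.
have [_ GD _ GI] := (sigma_algebraP (fun _ _ => @subsetT _ _)).1 sG.
apply: (Lsub_eq0 GM) => //.
- by have [? _ _] := (sigma_algebraP (fun _ _ => @subsetT _ _)).1 sG.
- apply: Lsub_mono (condE_Lsub hG z) => E GE.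
  by apply: sub_sigma_algebra; left.
- by move=> E GE; rewrite condE_dot ?zE//; exact: Lsub_ind.
Qed.

Lemma dot_indI (E E' : set Omega) : measurable E -> measurable E' ->
  ((dot (ind E) (ind E'))%:E = P (E `&` E'))%E.
Proof. by move=> mE mE'; rewrite dot_ind ?ind_sqint// integral_indic. Qed.

Lemma sqint_ae f g : f \in sqint -> measurable_fun setT g ->
  {ae P, forall w, f w = g w} -> g \in sqint.
Proof.
move=> f2 mg fg; apply: sqintP => //.
rewrite (_ : (\int[P]_w (g w ^+ 2)%:E = \int[P]_w (f w ^+ 2)%:E)%E).
  by rewrite dotfE// ltry.
apply: ae_eq_integral => //.
- exact/measurable_EFinP/measurable_funX.
- exact/measurable_EFinP/measurable_funX/(sqint_meas f2).
- by apply: filterS fg => w ->.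
Qed.

(** L2 is not closed under products; this is the product class when it is square integrable, as for
    independent factors. *)
Definition mulL x y : L2 := cls (rep x \* rep y).

Lemma mulLC x y : mulL x y = mulL y x.
Proof. by congr (cls _); apply/funext => w /=; rewrite mulrC. Qed.

Lemma mul_cls f g : f \in sqint -> g \in sqint -> f \* g \in sqint ->
  mulL (cls f) (cls g) = cls (f \* g).
Proof.
move=> f2 g2 fg2.
have mr : measurable_fun setT (rep (cls f) \* rep (cls g)).
  by apply: measurable_funM; exact: (sqint_meas (rep_sqint _)).
have ae : {ae P, forall w, (f \* g) w = (rep (cls f) \* rep (cls g)) w}.
  by have := rep_cls_ae f2; apply: filterS2 (rep_cls_ae g2) => w /= -> ->.
by apply/esym/cls_ae => //; exact: sqint_ae fg2 mr ae.
Qed.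

Lemma sqintM_ind f (E : set Omega) : f \in sqint -> measurable E -> f \* \1_E \in sqint.
Proof.
move=> f2 mE; apply: sqintP.
  by apply: measurable_funM; [exact: sqint_meas f2|exact: measurable_indic].
apply: le_lt_trans (_ : (\int[P]_w (f w ^+ 2)%:E < +oo)%E); last by rewrite dotfE// ltry.
apply: ge0_le_integral => //.
- by move=> w _; rewrite lee_fin sqr_ge0.
- apply/measurable_EFinP/measurable_funX/measurable_funM; first exact: sqint_meas f2.
  exact: measurable_indic.
- exact/measurable_EFinP/measurable_funX/(sqint_meas f2).
- move=> w _; rewrite lee_fin exprMn indicE; case: (_ \in _).
    by rewrite expr1n mulr1.
  by rewrite expr0n mulr0 sqr_ge0.
Qed.

Lemma mul_ind (E E' : set Omega) : measurable E -> measurable E' ->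
  mulL (ind E) (ind E') = ind (E `&` E').
Proof.
move=> mE mE'; rewrite mul_cls ?sqintM_ind ?ind_sqint//; congr (cls _).
by apply/funext => w; rewrite indicI.
Qed.

Lemma Lsub_mul G x y : sub_sigma_field G -> Lsub G x -> Lsub G y ->
  rep x \* rep y \in sqint -> Lsub G (mulL x y).
Proof.
move=> [sG GM NG] [f [f2 fG] xf] [g [g2 gG] yg] xy2.
have ae : {ae P, forall w, (rep x \* rep y) w = (f \* g) w}.
  by rewrite xf yg; have := rep_cls_ae f2; apply: filterS2 (rep_cls_ae g2) => w /= -> ->.
have mfg : measurable_fun setT (f \* g).
  by apply: measurable_funM; [exact: sqint_meas f2|exact: sqint_meas g2].
have fg2 := sqint_ae xy2 mfg ae.
exists (f \* g); last exact: cls_ae.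
by split=> //; apply/(fmeasP _ sG)/measurable_funM; apply/(fmeasP _ sG).
Qed.

Section independent_fields.
Context (G G' : set_system Omega).
Hypothesis hG : sub_sigma_field G.
Hypothesis hG' : sub_sigma_field G'.
Hypothesis GG' : independent P G G'.
Local Notation one := (ind setT).

Let GM E : G E -> measurable E. Proof. by case: hG => _ h _ /h. Qed.
Let GM' E : G' E -> measurable E. Proof. by case: hG' => _ h _ /h. Qed.

Lemma indep_dot x y : Lsub G x -> Lsub G' y -> dot x y = dot one x * dot one y.
Proof.
move=> xG yG'.
(* Independence is given on events; it is extended to one factor at a time. *)
have step1 E' : G' E' -> dot (ind E' - dot one (ind E') *: one) x = 0.
  move=> GE'; apply: (Lsub_orth hG xG) => E GE.
  rewrite (dotBl hH) (dotZl hH); apply/eqP; rewrite subr_eq0; apply/eqP.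
  have mE := GM GE; have mE' := GM' GE'.
  have oneE (F : set Omega) (mF : measurable F) : ((dot one (ind F))%:E = P F)%E.
    by rewrite dot_indI// setTI.
  have := dot_indI mE' mE; rewrite setIC (GG' GE GE') -(oneE _ mE) -(oneE _ mE').
  by rewrite -EFinM => h; exact: etrans (congr1 fine h) (mulrC _ _).
apply/eqP; rewrite -subr_eq0 -(dotZl hH) -(dotBl hH); apply/eqP.
apply: (Lsub_orth hG' yG') => E' GE'; have := step1 _ GE'.
rewrite !(dotBl hH) !(dotZl hH) (dotC hH (ind E')) => <-; ring.
Qed.

Lemma indep_dotf f g : f \in sqint -> fmeas G f -> g \in sqint -> fmeas G' g ->
  dotf P f g = dotf P \1_setT f * dotf P \1_setT g.
Proof.
move=> f2 fG g2 gG; rewrite -!dot_cls ?ind_sqint// indep_dot//.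
  by exists f.
by exists g.
Qed.

(** The squares are only integrable, so [indep_dotf] is applied to the truncations of [f^2] and
    [g^2] at level [n], and Fatou's lemma removes the truncation. *)
Lemma indep_mul f g : f \in sqint -> fmeas G f -> g \in sqint -> fmeas G' g ->
  (\int[P]_w ((f w * g w) ^+ 2)%:E <= (dotf P f f * dotf P g g)%:E)%E.
Proof.
move=> f2 fG g2 gG.
pose tr (h : Omega -> R) n w := Num.min (h w ^+ 2) n%:R.
have tr_meas K h n : sigma_algebra setT K -> fmeas K h -> fmeas K (tr h n).
  move=> sK hK; apply/(fmeasP _ sK); apply: measurable_minr => //.
  by apply: measurable_funX; apply/(fmeasP _ sK).
have tr_sq h n : h \in sqint -> tr h n \in sqint.
  move=> h2; apply: sqintP.
    by apply: measurable_minr => //; apply: measurable_funX; exact: sqint_meas h2.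
  apply: le_lt_trans (_ : (\int[P]_w (cst (n%:R ^+ 2)%:E w) < +oo)%E); last first.
    by apply: integrable_lty => //; exact: finite_measure_integrable_cst.
  apply: ge0_le_integral => //.
  - by move=> w _; rewrite lee_fin sqr_ge0.
  - apply/measurable_EFinP/measurable_funX/measurable_minr => //.
    by apply: measurable_funX; exact: sqint_meas h2.
  - move=> w _; rewrite lee_fin lerXn2r ?nnegrE ?ler0n// /tr.
      by rewrite le_min sqr_ge0 ler0n.
    by rewrite ge_min lexx orbT.
have tr0 h n w : 0 <= tr h n w by rewrite /tr le_min sqr_ge0 ler0n.
have tr_int h n : h \in sqint -> dotf P \1_setT (tr h n) <= dotf P h h.
  move=> h2; apply: le_Rintegral => //.
  - by apply: integrable_prod; [exact: ind_sqint|exact: tr_sq].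
  - exact: integrable_prod.
  - by move=> w _; rewrite indicE in_setT mul1r /tr ge_min expr2 lexx.
have [sG _ _] := hG; have [sG' _ _] := hG'.
pose v n w := (tr f n w * tr g n w)%:E.
have mtr h n : h \in sqint -> measurable_fun setT (tr h n).
  by move=> h2; exact: sqint_meas (tr_sq h n h2).
have -> : (\int[P]_w ((f w * g w) ^+ 2)%:E = \int[P]_w limn_einf (v ^~ w))%E.
  apply: eq_integral => w _; apply/esym.
  have /cvg_limn_einf_sup[-> //] : v n w @[n --> \oo] --> ((f w * g w) ^+ 2)%:E.
  apply: cvg_near_cst.
  exists (maxn (Num.truncn (f w ^+ 2)).+1 (Num.truncn (g w ^+ 2)).+1) => // n /=.
  rewrite geq_max => /andP[n1 n2]; rewrite /v /tr exprMn !min_l//.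
    by apply/ltW/(lt_le_trans (truncnS_gt _)); rewrite ler_nat.
  by apply/ltW/(lt_le_trans (truncnS_gt _)); rewrite ler_nat.
apply: le_trans (fatou _ _ _ _) _ => //.
- by move=> n; apply/measurable_EFinP/measurable_funM; exact: mtr.
- by move=> n w _; rewrite lee_fin mulr_ge0.
apply: einfs_le => n.
have -> : (\int[P]_w (tr f n w * tr g n w)%:E = (dotf P (tr f n) (tr g n))%:E)%E.
  by rewrite /dotf /Rintegral fineK//; apply: integrable_fin_num => //; apply: integrable_prod; exact: tr_sq.
rewrite lee_fin indep_dotf ?tr_sq//; try exact: tr_meas.
by apply: ler_pM; rewrite ?tr_int//; apply: Rintegral_ge0 => w _; rewrite indicE in_setT mul1r.
Qed.

End independent_fields.

End conditional_expectation.

(** * Products of independent square integrable classes *)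

Section products.
Context (d : measure_display) (Omega : measurableType d) (R : realType)
  (P : probability Omega R).
Local Notation sqint := (Lfun P 2%:E).
Local Notation cls := (cls P).
Local Notation L2 := (L2 P).
Local Notation dot := (@L2dot _ _ _ P).
Local Notation Lsub G := (@Lsub _ _ _ P G).
Local Notation sub_sigma_field := (sub_sigma_field P).
Local Notation sqn x := (dot x x).
Local Notation ind := (ind P).
Local Notation one := (ind setT).
Let hH := L2_hilbert P.
Implicit Types (f g h : Omega -> R) (x y : L2).

Lemma mulL1l y : mulL one y = y.
Proof.
have e : \1_setT \* rep y = rep y.
  by apply/funext => w /=; rewrite indicE in_setT mul1r.
rewrite -[in LHS](repK y) mul_cls ?ind_sqint ?rep_sqint ?e ?rep_sqint//.
exact: repK.
Qed.

Section independent_fields.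
Context (G G' : set_system Omega).
Hypothesis hG : sub_sigma_field G.
Hypothesis hG' : sub_sigma_field G'.
Hypothesis GG' : independent P G G'.

Let GM E : G E -> measurable E. Proof. by case: hG => _ h _ /h. Qed.
Let GM' E : G' E -> measurable E. Proof. by case: hG' => _ h _ /h. Qed.

Lemma indep_sqint f g : f \in sqint -> fmeas G f -> g \in sqint -> fmeas G' g ->
  f \* g \in sqint.
Proof.
move=> f2 fG g2 gG; apply: sqintP.
  by apply: measurable_funM; [exact: sqint_meas f2|exact: sqint_meas g2].
by apply: le_lt_trans (indep_mul hG hG' GG' f2 fG g2 gG) _; rewrite ltry.
Qed.

Lemma mul_sqint x y : Lsub G x -> Lsub G' y -> rep x \* rep y \in sqint.
Proof.
move=> [f [f2 fG] ->] [g [g2 gG] ->]; apply: (sqint_ae (indep_sqint f2 fG g2 gG)).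
  by apply: measurable_funM; exact: (sqint_meas (rep_sqint _)).
by have := rep_cls_ae f2; apply: filterS2 (rep_cls_ae g2) => w /= -> ->.
Qed.

Lemma mulL_linl a x x' y : Lsub G x -> Lsub G x' -> Lsub G' y ->
  mulL (a *: x + x') y = a *: mulL x y + mulL x' y.
Proof.
move=> xG x'G yG'; have [sG _ _] := hG.
have h1 := mul_sqint xG yG'; have h2 := mul_sqint x'G yG'.
rewrite -{1}(repK x) -{1}(repK x') -{1}(repK y) -cls_lin ?rep_sqint//.
have e : (a \*: rep x \+ rep x') \* rep y = a \*: (rep x \* rep y) \+ (rep x' \* rep y).
  by apply/funext => w /=; rewrite mulrDl scalerAl.
rewrite mul_cls ?sqint_lin ?rep_sqint ?e ?sqint_lin//.
by rewrite cls_lin.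
Qed.

Lemma mulL_sqn x y : Lsub G x -> Lsub G' y -> sqn (mulL x y) <= sqn x * sqn y.
Proof.
move=> [f [f2 fG] ->] [g [g2 gG] ->]; have fg2 := indep_sqint f2 fG g2 gG.
rewrite mul_cls// !dot_cls// -lee_fin -dotfE//.
exact: (indep_mul hG hG' GG' f2 fG g2 gG).
Qed.

Lemma mulL_dot_ind x y (E E' : set Omega) : Lsub G x -> Lsub G' y -> G E -> G' E' ->
  dot (mulL x y) (ind (E `&` E')) = dot x (ind E) * dot y (ind E').
Proof.
move=> [f [f2 fG] ->] [g [g2 gG] ->] GE GE'; have fg2 := indep_sqint f2 fG g2 gG.
have mE := GM GE; have mE' := GM' GE'.
have mEE' : measurable (E `&` E') by exact: measurableI.
have [sG _ _] := hG; have [sG' _ _] := hG'.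
have fmE : fmeas G (f \* \1_E).
  apply/(fmeasP _ sG)/measurable_funM; apply/(fmeasP _ sG) => //.
  exact: fmeas_indic.
have fmE' : fmeas G' (g \* \1_E').
  apply/(fmeasP _ sG')/measurable_funM; apply/(fmeasP _ sG') => //.
  exact: fmeas_indic.
rewrite mul_cls// !dot_cls ?ind_sqint//.
transitivity (dotf P (f \* \1_E) (g \* \1_E')).
  by apply: eq_Rintegral => w _ /=; rewrite indicI /=; ring.
rewrite (indep_dotf hG hG' GG') ?sqintM_ind//.
by congr (_ * _); apply: eq_Rintegral => w _ /=; rewrite indicE in_setT mul1r.
Qed.

End independent_fields.

Lemma independent_sym (G G' : set_system Omega) : independent P G G' -> independent P G' G.
Proof. by move=> h E E' GE GE'; rewrite setIC h// muleC. Qed.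

Lemma mulL_linr (G G' : set_system Omega) a x y y' :
  sub_sigma_field G -> sub_sigma_field G' -> independent P G G' ->
  Lsub G x -> Lsub G' y -> Lsub G' y' ->
  mulL x (a *: y + y') = a *: mulL x y + mulL x y'.
Proof.
move=> hG hG' /independent_sym GG' xG yG yG'.
by rewrite mulLC (mulL_linl hG' hG GG')// mulLC (mulLC y').
Qed.

Lemma mulL_sqnB (G G' : set_system Omega) x x' y y' :
  sub_sigma_field G -> sub_sigma_field G' -> independent P G G' ->
  Lsub G x -> Lsub G x' -> Lsub G' y -> Lsub G' y' ->
  sqn (mulL x y - mulL x' y') <=
    2 * (sqn (x - x') * sqn y + sqn x' * sqn (y - y')).
Proof.
move=> hG hG' GG' xG x'G yG yG'; have [sG _ _] := hG; have [sG' _ _] := hG'.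
apply: le_trans (sqn_addB hH _ (mulL x' y) _) _; rewrite ler_pM2l//.
have -> : mulL x y - mulL x' y = mulL (x - x') y.
  by rewrite addrC -scaleN1r -(mulL_linl hG hG' GG')// scaleN1r addrC.
have -> : mulL x' y - mulL x' y' = mulL x' (y - y').
  by rewrite addrC -scaleN1r -(mulL_linr _ hG hG' GG')// scaleN1r addrC.
by apply: lerD; apply: (mulL_sqn hG hG' GG') => //; exact: LsubB.
Qed.

Lemma mulL0l (y : L2) : mulL 0 y = 0.
Proof.
have e : cst 0 \* rep y = cst 0 by apply/funext => w /=; rewrite mul0r.
by rewrite -{1}(cls0 P) -(repK y) mul_cls ?e ?sqint0 ?rep_sqint ?repK ?cls0//;
  rewrite ?e ?sqint0.
Qed.

End products.

(** * Factorizations *)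

Section factorized_projections.
Context (d : measure_display) (Omega : measurableType d) (R : realType)
  (P : probability Omega R).
Context (T : Type) (calA : set_system T) (F : set T -> set_system Omega).
Hypothesis hA : sigma_algebra setT calA.
Hypothesis hF : forall A, calA A -> sub_sigma_field P (F A).
Hypothesis hi : forall A B, calA A -> calA B -> A `&` B = set0 ->
  independent P (F A) (F B) /\ F (A `|` B) = generated P (F A `|` F B).
Hypothesis hii : forall A_ : nat -> set T, (forall n, calA (A_ n)) ->
  (forall n, A_ n `<=` A_ n.+1) ->
  F (\bigcup_n A_ n) = generated P (\bigcup_n F (A_ n)).
Local Notation L2 := (L2 P).
Local Notation dot := (@L2dot _ _ _ P).
Local Notation Lsub G := (@Lsub _ _ _ P G).
Local Notation sqn x := (dot x x).
Local Notation ind := (ind P).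
Local Notation one := (ind setT).
Let hH := L2_hilbert P.
Implicit Types (x y : L2) (A B C : set T).

Definition Qf A : L2 -> L2 := @condE _ _ _ P (F A).

Let sF A : calA A -> sigma_algebra setT (F A).
Proof. by move=> /hF[]. Qed.

Lemma F_meas A E : calA A -> F A E -> measurable E.
Proof. by move=> /hF[_ h _] /h. Qed.

Lemma F_mono A B : calA A -> calA B -> A `<=` B -> F A `<=` F B.
Proof.
move=> cA cB AB; have cBA := calAD hA cB cA.
have [|_] := hi cA cBA; first by rewrite setDE setICA setICr setI0.
rewrite setDUK// => -> E FE.
by apply: sub_sigma_algebra; left; left.
Qed.

Lemma Lsub_FE A x : calA A -> Lsub (F A) x <-> Qf A x = x.
Proof.
move=> cA; split=> [|<-]; first exact: (condE_id (hF cA)).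
exact: (condE_Lsub (hF cA)).
Qed.

Lemma Lsub_Q A x : calA A -> Lsub (F A) (Qf A x).
Proof. by move=> cA; exact: (condE_Lsub (hF cA)). Qed.

Lemma Qf_sym A x y : calA A -> dot (Qf A x) y = dot x (Qf A y).
Proof. by move=> cA; exact: (condE_sym (hF cA)). Qed.

Lemma Qf_B A x y : calA A -> Qf A (x - y) = Qf A x - Qf A y.
Proof. by move=> cA; apply: (symB hH) => u v; exact: Qf_sym. Qed.

Lemma Q_ind A E x : calA A -> F A E -> dot (Qf A x) (ind E) = dot x (ind E).
Proof. by move=> cA FE; rewrite (condE_dot (hF cA))//; exact: (Lsub_ind (hF cA)). Qed.

Lemma setI_F A E E' : calA A -> F A E -> F A E' -> F A (E `&` E').
Proof.
move=> cA; have [_ _ _] := (sigma_algebraP (fun _ _ => @subsetT _ _)).1 (sF cA).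
exact.
Qed.

Lemma setT_F A : calA A -> F A setT.
Proof. by move=> cA; have [] := (sigma_algebraP (fun _ _ => @subsetT _ _)).1 (sF cA). Qed.

(** The intersections of an event of [F A] with one of [F B] form a pi-system generating the field
    of the union; identities below are tested on them. *)
Lemma Lsub_union_eq0 A B x : calA A -> calA B -> A `&` B = set0 ->
  Lsub (F (A `|` B)) x ->
  (forall E E', F A E -> F B E' -> dot x (ind (E `&` E')) = 0) -> x = 0.
Proof.
move=> cA cB AB xAB h; have [_ FAB] := hi cA cB AB; rewrite FAB in xAB.
pose Pi := [set E `&` E' | E in F A & E' in F B].
apply: (Lsub_eq0 (C := Pi)).
- move=> _ [E FE [E' FE' <-]]; exact: measurableI (F_meas cA FE) (F_meas cB FE').
- move=> _ _ [E FE [E' FE' <-]] [H FH [H' FH' <-]].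
  exists (E `&` H); first exact: setI_F.
  by exists (E' `&` H'); [exact: setI_F|rewrite setIACA].
- by exists setT; [exact: setT_F|exists setT; [exact: setT_F|rewrite setIT]].
- apply: Lsub_mono xAB; apply: smallest_sub; first exact: smallest_sigma_algebra.
  move=> E [[FE|FE]|NE]; apply: sub_sigma_algebra; [left|left|by right].
    by exists E => //; exists setT; [exact: setT_F|rewrite setIT].
  by exists setT; [exact: setT_F|exists E => //; rewrite setTI].
- by move=> _ [E FE [E' FE' <-]]; exact: h.
Qed.

(** [F A] is generated by the parts of [A] inside and outside [B]; the outer part is independent of
    [F B], so it contributes only a scalar factor to each test. *)
Lemma Q_meet A B x : calA A -> calA B -> Lsub (F B) x -> Qf A x = Qf (A `&` B) x.
Proof.
move=> cA cB xB; have cAB := calAI hA cA cB; have cD := calAD hA cA cB.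
have ABD : A `&` B `|` A `\` B = A by rewrite setUIDK.
have disj : A `&` B `&` (A `\` B) = set0 by rewrite setDE setIACA setICr setI0.
apply/eqP; rewrite -subr_eq0; apply/eqP.
apply: (Lsub_union_eq0 cAB cD disj).
  rewrite ABD; apply: LsubB; [exact: sF|exact: Lsub_Q|].
  by apply: Lsub_mono (Lsub_Q _ cAB); apply: F_mono => //; exact: subIsetl.
move=> E E' FE FE'.
have FAE : F A E by apply: F_mono FE => //; exact: subIsetl.
have FAE' : F A E' by apply: F_mono FE' => //; exact: subDsetl.
have FBE : F B E by apply: F_mono FE => //; exact: subIsetr.
have [|indB _] := hi cB cD; first by rewrite setDE setICA setICr setI0.
have factor y : Lsub (F B) y ->
    dot y (ind (E `&` E')) = dot y (ind E) * dot one (ind E').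
  move=> yB; have oneD : Lsub (F (A `\` B)) one.
    by apply: (Lsub_ind (hF cD)); exact: setT_F.
  by rewrite -(mulL_dot_ind (hF cB) (hF cD) indB)// mulLC mulL1l.
have QB : Lsub (F B) (Qf (A `&` B) x).
  by apply: Lsub_mono (Lsub_Q _ cAB); apply: F_mono => //; exact: subIsetr.
rewrite (dotBl hH) (Q_ind _ cA); last exact: setI_F.
by rewrite !factor// (Q_ind _ cAB)// subrr.
Qed.

Lemma Q_comp A B x : calA A -> calA B -> Qf A (Qf B x) = Qf (A `&` B) x.
Proof.
move=> cA cB; have cAB := calAI hA cA cB.
rewrite (Q_meet cA cB (Lsub_Q _ cB)); apply: (condE_unique (hF cAB)).
  exact: Lsub_Q.
move=> s sAB; rewrite (condE_dot (hF cAB))// (condE_dot (hF cB))//.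
by apply: Lsub_mono sAB; apply: F_mono => //; exact: subIsetr.
Qed.

(** The errors [u n] form a decreasing net. Their limit is [F A]-measurable and orthogonal to every
    event of the [F (A_ n)], which generate [F A] by [hii]; so it is 0. *)
Lemma Q_cont (A_ : nat -> set T) x (e : R) : (forall n, calA (A_ n)) ->
  (forall n, A_ n `<=` A_ n.+1) -> 0 < e ->
  exists n, sqn (Qf (\bigcup_n A_ n) x) - sqn (Qf (A_ n) x) <= e.
Proof.
move=> cA_ incA e0; set A := \bigcup_n A_ n.
have cA : calA A by exact: calA_bigcup.
have subA n : A_ n `<=` A by exact: bigcup_sup.
have mono n m : (n <= m)%N -> A_ n `<=` A_ m.
  move=> nm; rewrite -(subnK nm); elim: (m - n)%N => // k IH.
  by rewrite addSn; apply: subset_trans IH _; exact: incA.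
pose u n := Qf A x - Qf (A_ n) x.
have QA n : Qf A (Qf (A_ n) x) = Qf (A_ n) x by rewrite Q_comp// (setIidr (subA n)).
have usqn n m : (n <= m)%N -> dot (u n) (u m) = sqn (u m).
  move=> nm; rewrite /u !(dotBl hH) !(dotBr hH).
  have Qd k l : (k <= l)%N -> dot (Qf (A_ k) x) (Qf (A_ l) x) = dot x (Qf (A_ k) x).
    move=> kl; rewrite (Qf_sym _ _ (cA_ k)) Q_comp//.
    by rewrite (setIidl (mono _ _ kl)).
  have QdA k : dot (Qf A x) (Qf (A_ k) x) = dot x (Qf (A_ k) x).
    by rewrite (Qf_sym _ _ cA) QA.
  rewrite Qd// !QdA !(dotC hH (Qf (A_ _) x) (Qf A x)) !QdA Qd//; ring.
have [w hw] := decreasing_net_cvg hH 0%N (fun n m => ex_intro (fun k => (n <= k)%N /\ (m <= k)%N)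
  (maxn n m) (conj (leq_maxl n m) (leq_maxr n m))) usqn.
have wA : Lsub (F A) w.
  apply/(Lsub_FE _ cA); apply: (dot_ext hH) => z.
  rewrite (Qf_sym _ _ cA); apply/eqP; rewrite -subr_eq0 -(dotBr hH); apply/eqP.
  apply: (dot_closed hH) => e' /hw[n hn]; exists (u n); first exact: hn.
  rewrite (dotBr hH) -(Qf_sym _ _ cA).
  by rewrite /u Qf_B// Q_comp// setIid QA subrr.
have w0 : w = 0.
  apply: (Lsub_eq0 (C := \bigcup_n F (A_ n))).
  - by move=> E [n _ /(F_meas (cA_ n))].
  - move=> E E' [n _ FE] [m _ FE']; exists (maxn n m) => //; apply: setI_F => //.
      by apply: F_mono FE => //; apply: mono; exact: leq_maxl.
    by apply: F_mono FE' => //; apply: mono; exact: leq_maxr.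
  - by exists 0%N => //; exact: setT_F.
  - by rewrite -hii.
  - move=> E [n _ FE]; apply: (dot_closed hH) => e' /hw[m hm].
    exists (u (maxn n m)); first by apply: hm; exact: leq_maxr.
    have FnE : F (A_ (maxn n m)) E by apply: F_mono FE => //; apply: mono; exact: leq_maxl.
    rewrite /u (dotBl hH) (Q_ind _ cA) ?(Q_ind _ (cA_ _)) ?subrr//.
    by apply: F_mono FnE.
have [n hn] := hw _ e0; exists n.
have := hn n (leqnn n); rewrite w0 subr0.
rewrite /u (sqnB hH) !(Qf_sym _ _ cA) !QA Q_comp// setIid.
by rewrite (Qf_sym _ _ (cA_ n)) Q_comp// setIid; lra.
Qed.


Lemma factorization_projections : boolean_projections dot calA Qf.
Proof. by split; [move=> A x y; exact: Qf_sym|move=> A B x; exact: Q_comp|exact: Q_cont]. Qed.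
Let hQ := factorization_projections.

Lemma Lsub_QI A B x : calA A -> calA B -> Lsub (F B) x -> Lsub (F B) (Qf A x).
Proof.
move=> cA cB xB; have cAB := calAI hA cA cB.
rewrite (Q_meet cA cB xB); apply: Lsub_mono (Lsub_Q _ cAB).
by apply: F_mono => //; exact: subIsetr.
Qed.

(** The empty set is disjoint from itself, so its field is independent of itself and
    [P E = P E * P E]. *)
Lemma F0_trivial E : F set0 E -> null_sets P E \/ null_sets P (~` E).
Proof.
have c0 := calA0 hA; move=> FE; have mE := F_meas c0 FE.
have [|ind0 _] := hi c0 c0; first by rewrite setI0.
have := ind0 E E FE FE; rewrite setIid => h.
have Pf : P E \is a fin_num by exact: fin_num_measure.
have : fine (P E) * (1 - fine (P E)) = 0.
  by rewrite mulrBr mulr1 -fineM// -h subrr.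
move=> /eqP; rewrite mulf_eq0 => /orP[/eqP e|/eqP e]; [left|right]; split=> //.
- by rewrite -(fineK Pf) e.
- exact: measurableC.
- by rewrite probability_setC// -(fineK Pf) -EFinB e.
Qed.

Lemma F0_generated (C : set_system Omega) : F set0 `<=` generated P C.
Proof.
move=> E /F0_trivial[h|h]; first by apply: sub_sigma_algebra; right.
have [_ + _] := smallest_sigma_algebra setT (C `|` null_sets P).
move=> /(_ (~` E)); rewrite setTD setCK; apply.
by apply: sub_sigma_algebra; right.
Qed.

Lemma indep_setC A : calA A -> independent P (F A) (F (~` A)).
Proof.
by move=> cA; have [|h _] := hi cA (calAC hA cA); first by rewrite setICr.
Qed.

(** Both sides are tested on products of events from the parts of [B] inside and outside [C], where
    each pairing factorizes. *)
Lemma Q_mul B C x y : calA B -> calA C -> Lsub (F C) x -> Lsub (F (~` C)) y ->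
  Qf B (mulL x y) = mulL (Qf B x) (Qf B y).
Proof.
move=> cB cC xC yC; have cC' := calAC hA cC; have iC := indep_setC cC.
have QxC := Lsub_QI cB cC xC; have QyC := Lsub_QI cB cC' yC.
have QyB := Lsub_Q y cB; have QxB := Lsub_Q x cB.
have mB : Lsub (F B) (mulL (Qf B x) (Qf B y)).
  by apply: (Lsub_mul (hF cB)) => //; exact: (mul_sqint (hF cC) (hF cC') iC).
apply/eqP; rewrite -subr_eq0 -{1}((Lsub_FE _ cB).1 mB) -Qf_B//; apply/eqP.
have cBC := calAI hA cB cC; have cD := calAD hA cB cC.
have BCD : B `&` C `|` B `\` C = B by rewrite setUIDK.
have disj : B `&` C `&` (B `\` C) = set0 by rewrite setDE setIACA setICr setI0.
apply: (Lsub_union_eq0 cBC cD disj); first by rewrite BCD; exact: Lsub_Q.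
move=> E E' FE FE'.
have FBE : F B E by apply: F_mono FE => //; exact: subIsetl.
have FBE' : F B E' by apply: F_mono FE' => //; exact: subDsetl.
have FCE : F C E by apply: F_mono FE => //; exact: subIsetr.
have FCE' : F (~` C) E' by apply: F_mono FE' => // t [].
rewrite (Q_ind _ cB); last exact: setI_F.
rewrite (dotBl hH) !(mulL_dot_ind (hF cC) (hF cC') iC)//.
by rewrite (Q_ind _ cB FBE) (Q_ind _ cB FBE') subrr.
Qed.

Lemma mulL_suml (G G' : set_system Omega) I (r : seq I) (f : I -> L2) y :
  sub_sigma_field P G -> sub_sigma_field P G' -> independent P G G' ->
  (forall i, Lsub G (f i)) -> Lsub G' y ->
  mulL (\sum_(i <- r) f i) y = \sum_(i <- r) mulL (f i) y.
Proof.
move=> hG hG' GG' fG yG'; have [sG _ _] := hG; elim: r => [|i r IH].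
  by rewrite !big_nil mulL0l.
rewrite !big_cons -IH -[f i]scale1r (mulL_linl hG hG' GG')// ?scale1r//.
exact: Lsub_sum.
Qed.

Lemma mulLDl (G G' : set_system Omega) x x' y :
  sub_sigma_field P G -> sub_sigma_field P G' -> independent P G G' ->
  Lsub G x -> Lsub G x' -> Lsub G' y -> mulL (x + x') y = mulL x y + mulL x' y.
Proof.
by move=> hG hG' GG' xG x'G yG'; rewrite -{1}[x]scale1r (mulL_linl hG hG' GG')// scale1r.
Qed.

Lemma mulLBl (G G' : set_system Omega) x x' y :
  sub_sigma_field P G -> sub_sigma_field P G' -> independent P G G' ->
  Lsub G x -> Lsub G x' -> Lsub G' y -> mulL (x - x') y = mulL x y - mulL x' y.
Proof.
move=> hG hG' GG' xG x'G yG'.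
by rewrite addrC -scaleN1r (mulL_linl hG hG' GG')// scaleN1r addrC.
Qed.

Local Notation coloring := (coloring calA).
Local Notation thinQ A c x := (thin Qf A (c : coloring) x).

Lemma calA_thin A (c : coloring) l : calA A -> calA (~` A `|` (A `&` c @^-1` [set l])).
Proof.
move=> cA; apply: (calAU hA (calAC hA cA)); apply: (calAI hA cA).
exact: coloring_meas.
Qed.

Lemma Lsub_thin A B c x : calA A -> calA B -> Lsub (F B) x -> Lsub (F B) (thinQ A c x).
Proof.
move=> cA cB xB; have cA' := calAC hA cA; have sB := sF cB.
apply: LsubD => //; first exact: Lsub_QI.
apply: Lsub_sum => // l; apply: LsubB => //; apply: Lsub_QI => //.
exact: calA_thin.
Qed.

(** Every set entering [thin A] contains the complement of [A], so its projection fixes [y], which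
    factors out by [Q_mul]. *)
Lemma thin_mulr A c x y : calA A -> Lsub (F A) x -> Lsub (F (~` A)) y ->
  thinQ A c (mulL x y) = mulL (thinQ A c x) y.
Proof.
move=> cA xA yA; have cA' := calAC hA cA.
have hA1 := hF cA; have hA2 := hF cA'; have ii := indep_setC cA; have sA := sF cA.
have QM B : calA B -> ~` A `<=` B -> Qf B (mulL x y) = mulL (Qf B x) y.
  move=> cB AB; rewrite (Q_mul cB cA)//; congr mulL; apply/(Lsub_FE _ cB).
  by apply: Lsub_mono yA; exact: F_mono.
have QA B : calA B -> Lsub (F A) (Qf B x) by move=> cB; exact: Lsub_QI.
have cl (l : color c) := calA_thin l cA.
rewrite /thin (mulLDl hA1 hA2 ii)//; last 2 first.
- exact: QA.
- by apply: Lsub_sum => // l; apply: LsubB => //; apply: QA => //; exact: cl.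
rewrite QM// (mulL_suml _ hA1 hA2 ii)//; last first.
  by move=> l; apply: LsubB => //; apply: QA => //; exact: cl.
congr (_ + _); apply: eq_bigr => l _.
rewrite QM; [|exact: cl|exact: subsetUl].
by rewrite (mulLBl hA1 hA2 ii)//; apply: QA => //; exact: cl.
Qed.

(** Here [C] lies in the complement of [A], so [x] is the factor fixed by every projection. *)
Lemma thin_mull A C c x y : calA A -> calA C -> C `&` A = set0 ->
  Lsub (F C) x -> Lsub (F (~` C)) y -> thinQ A c (mulL x y) = mulL x (thinQ A c y).
Proof.
move=> cA cC CA xC yC; have cA' := calAC hA cA; have cC' := calAC hA cC.
have h1 := hF cC; have h2 := hF cC'; have ii := indep_setC cC; have sC := sF cC'.
have ii' := independent_sym ii.
have CA' : C `<=` ~` A by move=> t Ct At; have : (C `&` A) t by []; rewrite CA.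
have QM B : calA B -> ~` A `<=` B -> Qf B (mulL x y) = mulL (Qf B y) x.
  move=> cB AB; rewrite (Q_mul cB cC)// mulLC; congr mulL; apply/(Lsub_FE _ cB).
  by apply: Lsub_mono xC; apply: F_mono => //; exact: subset_trans AB.
have QC B : calA B -> Lsub (F (~` C)) (Qf B y) by move=> cB; exact: Lsub_QI.
have cl (l : color c) := calA_thin l cA.
rewrite [RHS]mulLC /thin (mulLDl h2 h1 ii')//; last 2 first.
- exact: QC.
- by apply: Lsub_sum => // l; apply: LsubB => //; apply: QC => //; exact: cl.
rewrite QM// (mulL_suml _ h2 h1 ii')//; last first.
  by move=> l; apply: LsubB => //; apply: QC => //; exact: cl.
congr (_ + _); apply: eq_bigr => l _.
rewrite QM; [|exact: cl|exact: subsetUl].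
by rewrite (mulLBl h2 h1 ii')//; apply: QC => //; exact: cl.
Qed.

(** On [F A] a projection sees only the trace on [A]: the complement of [A] acts as [set0], and each
    enlarged cell acts as the cell. The first term is the expectation. *)
Lemma thin_chaos A c x : calA A -> Lsub (F A) x ->
  thinQ A c x = Qf set0 x + chaos Qf c x.
Proof.
move=> cA xA; have cA' := calAC hA cA; have QAx := (Lsub_FE _ cA).1 xA.
have e0 : Qf (~` A) x = Qf set0 x by rewrite (Q_meet cA' cA xA) setICl.
rewrite /thin e0; congr (_ + _); apply: eq_bigr => l _; congr (_ - _).
have cl := calA_thin l cA; have cc := @coloring_meas _ _ c l.
by rewrite (Q_meet cl cA xA) [RHS](Q_meet cc cA xA) setIUl setICl set0U setIAC setIid setIC.
Qed.

End factorized_projections.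

(** * Linearization *)

(** Error budget for [lprod_cvg]: each of the two terms is at most [r / 4]. *)
Lemma product_error_le (R : realFieldType) (a b q p x r : R) :
  0 <= a -> 0 <= b -> 0 <= q -> 0 <= p -> 0 <= x -> 0 < r ->
  a <= r / (8 * (p + 1)) -> q <= 2 * (1 + p) -> b <= r / (4 * (x + 1)) ->
  2 * (a * q + x * b) <= r.
Proof.
move=> a0 b0 q0 p0 x0 r0 ha hq hb.
have p1 : 0 < p + 1 by lra.
have x1 : 0 < x + 1 by lra.
have u1 : a * q <= r / 4.
  apply: le_trans (ler_pM a0 q0 ha hq) _; rewrite (addrC 1 p).
  by rewrite le_eqVlt; apply/orP; left; apply/eqP; field; rewrite gt_eqF.
have u2 : x * b <= r / 4.
  apply: le_trans (ler_wpM2l x0 hb) _.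
  by rewrite mulrA ler_pdivrMr ?mulr_gt0//; nra.
lra.
Qed.

Section linearization.
Context (d : measure_display) (Omega : measurableType d) (R : realType)
  (P : probability Omega R).
Context (T : Type) (calA : set_system T) (F : set T -> set_system Omega).
Hypothesis hA : sigma_algebra setT calA.
Hypothesis hF : forall A, calA A -> sub_sigma_field P (F A).
Hypothesis hi : forall A B, calA A -> calA B -> A `&` B = set0 ->
  independent P (F A) (F B) /\ F (A `|` B) = generated P (F A `|` F B).
Hypothesis hii : forall A_ : nat -> set T, (forall n, calA (A_ n)) ->
  (forall n, A_ n `<=` A_ n.+1) ->
  F (\bigcup_n A_ n) = generated P (\bigcup_n F (A_ n)).
Local Notation sqint := (Lfun P 2%:E).
Local Notation L2 := (L2 P).
Local Notation cls := (cls P).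
Local Notation dot := (@L2dot _ _ _ P).
Local Notation Lsub G := (@Lsub _ _ _ P G).
Local Notation sqn x := (dot x x).
Local Notation ind := (ind P).
Local Notation one := (ind setT).
Local Notation Q := (@Qf _ _ _ P _ F).
Local Notation coloring := (coloring calA).
Local Notation thinQ A c x := (thin Q A (c : coloring) x).
Let hH := L2_hilbert P.
Let hQ : boolean_projections dot calA Q := factorization_projections hA hF hi hii.
Implicit Types (x y : L2) (A B C : set T).

Lemma exists_RV (f : Omega -> R) : measurable_fun setT f ->
  exists X : {RV P >-> R}, (X : Omega -> R) = f.
Proof.
by move=> mf; exists (mfun_Sub (mem_set mf)).
Qed.

(** Chebyshev's inequality, linking L2 distance to convergence in probability. *)
Lemma deviation_bound (f g : Omega -> R) (e : R) : f \in sqint -> g \in sqint -> 0 < e ->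
  ((e ^+ 2)%:E * P [set w | (e <= `|f w - g w|)%R] <= (sqn (cls f - cls g))%:E)%E.
Proof.
move=> f2 g2 e0; have fg2 := sqintB f2 g2; rewrite -clsB// dot_cls// -dotfE//.
have /measurable_EFinP mh : measurable_fun setT (fun w => (f w - g w) ^+ 2).
  exact/measurable_funX/(sqint_meas fg2).
have := le_integral_abse P measurableT mh (exprn_gt0 2 e0); rewrite setTI.
have E v : ((e ^+ 2)%:E <= `|(v ^+ 2)%:E|)%E = (e <= `|v|).
  by rewrite gee0_abs ?lee_fin ?sqr_ge0// -(real_normK (num_real v)) ler_pXn2r// nnegrE// ltW.
rewrite (_ : [set w | _] = [set w | (e <= `|f w - g w|)%R]); last first.
  by apply/seteqP; split=> w /=; rewrite E.
move=> h; apply: le_trans h _; rewrite le_eqVlt; apply/orP; left; apply/eqP.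
by apply: eq_integral => w _; rewrite gee0_abs// lee_fin sqr_ge0.
Qed.

Lemma deviation_meas (f g : Omega -> R) (e : R) :
  measurable_fun setT f -> measurable_fun setT g ->
  measurable [set w | (e <= `|f w - g w|)%R].
Proof.
move=> mf mg; have mh : measurable_fun setT (fun w => `|f w - g w|).
  by apply: measurableT_comp => //; exact: measurable_funB.
have := mh measurableT [set` `[e, +oo[] (measurable_itv _); rewrite setTI.
congr (measurable _); apply/seteqP; split=> w; rewrite /= in_itv /= andbT//.
Qed.

Lemma process_of_chaos (psi : L2) :
  (forall A B, calA A -> calA B -> A `&` B = set0 ->
    Q (A `|` B) psi = Q A psi + Q B psi) ->
  exists X : set T -> {RV P >-> R}, decomposable_process calA F X /\
    forall A, calA A ->
      [/\ (X A : Omega -> R) \in sqint, fmeas (F A) (X A) & cls (X A) = Q A psi].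
Proof.
move=> add.
have /choice[X hX] : forall A, exists X : {RV P >-> R}, calA A ->
    [/\ (X : Omega -> R) \in sqint, fmeas (F A) X & cls X = Q A psi].
  move=> A; have [cA|nA] := pselect (calA A); last first.
    by have [X _] := exists_RV (@measurable_cst _ _ Omega R setT 0); exists X.
  have [f [f2 fF] fE] := Lsub_Q hF psi cA.
  by have [X XE] := exists_RV (sqint_meas f2); exists X => _; rewrite XE.
exists X; split=> //; split.
- move=> A cA _ [B mB <-]; rewrite setTI; have [_ h _] := hX _ cA; exact: h.
- move=> A B cA cB AB; have [A2 _ AE] := hX _ cA; have [B2 _ BE] := hX _ cB.
  have [U2 _ UE] := hX _ (calAU hA cA cB).
  have AB2 : (X A \+ X B : Omega -> R) \in sqint.
    have -> : (X A \+ X B : Omega -> R) = 1 \*: (X A : Omega -> R) \+ (X B : Omega -> R).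
      by apply/funext => w /=; rewrite scale1r.
    exact: sqint_lin.
  apply: (cls_inj_ae U2 AB2); rewrite UE add//.
  have -> : (X A \+ X B : Omega -> R) = 1 \*: (X A : Omega -> R) \+ (X B : Omega -> R).
    by apply/funext => w /=; rewrite scale1r.
  by rewrite cls_lin// scale1r AE BE.
move=> A_ cA_ incA e e0; set A := \bigcup_n A_ n.
have cA : calA A by exact: calA_bigcup.
have [X2 _ XE] := hX _ cA.
have mono n m : (n <= m)%N -> A_ n `<=` A_ m.
  move=> nm; rewrite -(subnK nm); elim: (m - n)%N => // k IH.
  by rewrite addSn; apply: subset_trans IH _; exact: incA.
(* [Q (A_ n) psi] is a projection of [Q A psi], so Pythagoras turns continuity of norms into L2
   convergence. *)
have dist n : sqn (cls (X (A_ n)) - cls (X A)) = sqn (Q A psi) - sqn (Q (A_ n) psi).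
  have [_ _ nE] := hX _ (cA_ n); rewrite nE XE (sqnB hH).
  rewrite !(Qsym hQ)// !(bp_comp hQ)// !setIid (setIidl (bigcup_sup _))//.
  by ring.
have mdev n : measurable [set w | (e <= `|X (A_ n) w - X A w|)%R].
  exact: deviation_meas.
apply: cvg_EFin.
  by apply: nearW => n; exact: fin_num_measure.
apply/cvgrPdist_le => eta eta0; have e2 : 0 < e ^+ 2 by rewrite exprn_gt0.
have [N hN] := bp_cont hQ psi cA_ incA (mulr_gt0 e2 eta0).
exists N => // n /= Nn; rewrite sub0r normrN.
have [n2 _ _] := hX _ (cA_ n).
have := deviation_bound n2 X2 e0; rewrite dist; set p := P _ => hp.
have pf : p \is a fin_num by exact: fin_num_measure.
have p0 : 0 <= fine p by rewrite fine_ge0// measure_ge0.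
rewrite ger0_norm// -(ler_pM2l e2) -lee_fin EFinM fineK//.
apply: le_trans hp _; rewrite lee_fin; apply: le_trans hN.
by rewrite lerD2l lerN2; apply: (Q_mono hH hQ) => //; exact: mono.
Qed.

Definition linear_field A : set_system Omega := generated P
  (\bigcup_(X in decomposable_process (P:=P) calA F) g_sigma_algebra_preimage (X A)).

Lemma linear_field_sub A : calA A -> linear_field A `<=` F A.
Proof.
move=> cA; have [sF _ NF] := hF cA; apply: smallest_sub => // E [[X [hX _ _] XE]|/NF//].
exact: hX XE.
Qed.

Lemma linear_sub_sigma_field A : calA A -> sub_sigma_field P (linear_field A).
Proof.
move=> cA; apply: sub_sigma_field_generated => E [X [hX _ _] /(hX _ cA)].
exact: (F_meas hF).
Qed.

Lemma chaos_linear A psi : calA A -> Q A psi = psi ->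
  (forall B C, calA B -> calA C -> B `&` C = set0 ->
    Q (B `|` C) psi = Q B psi + Q C psi) -> Lsub (linear_field A) psi.
Proof.
move=> cA QA /process_of_chaos[X [dX hX]]; have [X2 _ XE] := hX _ cA.
exists (X A); last by rewrite XE.
split=> // B mB; apply: sub_sigma_algebra; left; exists X => //.
by exists B => //; rewrite setTI.
Qed.

Lemma F0_linear A : calA A -> F set0 `<=` linear_field A.
Proof. by move=> cA; exact: (F0_generated hA hF hi). Qed.

(** * Products over the cells of one partition *)

Section products_over_cells.
Context (c : coloring).
Implicit Types (s : seq (color c)) (v : color c -> L2).
Local Notation C k := (c @^-1` [set k]).
Let cC k : calA (C k) := coloring_meas k.

Definition region s : set T := [set t | c t \in s].

Lemma calA_region s : calA (region s).
Proof.
have -> : region s = cell [set k in s]%SET; last exact: cell_meas.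
by apply/seteqP; split=> t; rewrite /region /cell /= inE.
Qed.
Let cR := calA_region.

Lemma region_sub k s : region s `<=` region (k :: s).
Proof. by move=> t; rewrite /region /= inE => ->; rewrite orbT. Qed.

Lemma cell_sub_region k s : C k `<=` region (k :: s).
Proof. by move=> t; rewrite /region /= inE => ->; rewrite eqxx. Qed.

Lemma region_disj k s : k \notin s -> C k `&` region s = set0.
Proof.
move=> ks; apply/seteqP; split=> // t [/= tk]; rewrite /region /= tk => h.
by rewrite h in ks.
Qed.

Lemma region_setC k s : k \notin s -> region s `<=` ~` C k.
Proof. by move=> ks t st /= tk; rewrite /region /= tk in st; rewrite st in ks. Qed.

Definition lprod v s : L2 := foldr (fun k => mulL (v k)) one s.

Lemma indep_region k s : k \notin s -> independent P (F (C k)) (F (region s)).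
Proof. by move=> ks; have [h _] := hi (cC k) (cR s) (region_disj ks). Qed.

Lemma lprod_Lsub v s : uniq s -> (forall k, Lsub (F (C k)) (v k)) ->
  Lsub (F (region s)) (lprod v s).
Proof.
move=> us hv; elim: s us => [_|k s IH /= /andP[ks us]].
  by apply: (Lsub_ind (hF (cR _))); exact: (setT_F hF (cR _)).
have hs := IH us; have ii := indep_region ks.
apply: (Lsub_mul (hF (cR _))).
- by apply: Lsub_mono (hv k); apply: (F_mono hA hi) => //; exact: cell_sub_region.
- by apply: Lsub_mono hs; apply: (F_mono hA hi) => //; exact: region_sub.
- exact: (mul_sqint (hF (cC k)) (hF (cR s)) ii).
Qed.

(** Independence over disjoint cells supplies square integrability, the second hypothesis on [v]
    supplies measurability; it serves for the linear field. *)
Lemma lprod_Lsub_gen (G : set_system Omega) v s : sub_sigma_field P G -> uniq s ->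
  (forall k, Lsub (F (C k)) (v k)) -> (forall k, Lsub G (v k)) -> Lsub G (lprod v s).
Proof.
move=> hG us hv gv; elim: s us => [_|k s IH /= /andP[ks us]].
  have [sG _ _] := hG; apply: (Lsub_ind hG).
  by have [] := (sigma_algebraP (fun _ _ => @subsetT _ _)).1 sG.
apply: (Lsub_mul hG) => //; first exact: IH.
apply: (mul_sqint (hF (cC k)) (hF (cR s)) (indep_region ks) (hv k)).
exact: lprod_Lsub.
Qed.

Definition cap (E : color c -> set Omega) s : set Omega :=
  foldr (fun k => setI (E k)) setT s.

Lemma cap_meas E s : (forall k, measurable (E k)) -> measurable (cap E s).
Proof. by move=> mE; elim: s => [|k s IH] //=; exact: measurableI. Qed.

Lemma lprod_ind E s : (forall k, measurable (E k)) ->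
  lprod (fun k => ind (E k)) s = ind (cap E s).
Proof.
move=> mE; elim: s => [//|k s IH /=]; rewrite IH mul_ind//.
exact: cap_meas.
Qed.

Definition thins e s x : L2 := foldr (fun k y => thinQ (C k) e y) x s.

Lemma thins_Lsub e s x B : calA B -> Lsub (F B) x -> Lsub (F B) (thins e s x).
Proof.
move=> cB xB; elim: s => [//|k s IH /=].
exact: (Lsub_thin hA hF hi).
Qed.

Lemma thins_mull e s j x y : j \notin s -> Lsub (F (C j)) x -> Lsub (F (~` C j)) y ->
  thins e s (mulL x y) = mulL x (thins e s y).
Proof.
move=> + xj yj; elim: s => [//|k s IH /=]; rewrite inE negb_or => /andP[jk js].
rewrite (IH js) (thin_mull hA hF hi _ (cC k) (cC j))//; last first.
  by apply: thins_Lsub => //; exact: calAC.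
by apply/seteqP; split=> // t [/= -> jk']; rewrite jk' eqxx in jk.
Qed.

(** Thinning on a cell affects only the factor living on that cell. *)
Lemma thins_lprod e v s : uniq s -> (forall k, Lsub (F (C k)) (v k)) ->
  thins e s (lprod v s) = lprod (fun k => thinQ (C k) e (v k)) s.
Proof.
move=> us hv.
have ht k : Lsub (F (C k)) (thinQ (C k) e (v k)) by exact: (Lsub_thin hA hF hi).
elim: s us => [//|k s IH /= /andP[ks us]].
have sub w : (forall k, Lsub (F (C k)) (w k)) -> Lsub (F (~` C k)) (lprod w s).
  move=> hw; apply: Lsub_mono (lprod_Lsub us hw); apply: (F_mono hA hi) => //.
    exact: calAC.
  exact: region_setC.
rewrite -[LHS]/(thinQ (C k) e (thins e s (mulL (v k) (lprod v s)))).
rewrite (thins_mull _ ks (hv k) (sub _ hv)) IH// (thin_mulr hA hF hi)//.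
exact: sub.
Qed.

Lemma lprod_cvg (v : coloring -> color c -> L2) (x : color c -> L2) s : uniq s ->
  (forall e k, Lsub (F (C k)) (v e k)) -> (forall k, Lsub (F (C k)) (x k)) ->
  (forall k (r : R), 0 < r -> exists e0, forall e, coarser e0 e ->
    sqn (v e k - x k) <= r) ->
  forall r : R, 0 < r -> exists e0, forall e, coarser e0 e ->
    sqn (lprod (v e) s - lprod x s) <= r.
Proof.
move=> us hv hx vx; elim: s us => [_ r r0|k s IH /= /andP[ks us] r r0].
  by exists (trivial_coloring hA) => e _ /=; rewrite subrr (dot0l hH) ltW.
set p := lprod x s.
have px : Lsub (F (region s)) p by exact: lprod_Lsub.
have p0 := dot_ge0 hH p; have x0 := dot_ge0 hH (x k).
have P1 : 0 < sqn p + 1 by exact: ltr_wpDl.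
have X1 : 0 < sqn (x k) + 1 by exact: ltr_wpDl.
have [e1 h1] := vx k (r / (8 * (sqn p + 1))) (divr_gt0 r0 (mulr_gt0 (ltr0Sn R 7) P1)).
(* The bound by 1 keeps the approximating product bounded, with [sqn] at most [2 * (1 + sqn p)]. *)
have rm : 0 < Num.min 1 (r / (4 * (sqn (x k) + 1))).
  by rewrite lt_min ltr01 divr_gt0// mulr_gt0.
have [e2 h2] := IH us _ rm.
have [e3 [e13 e23]] := coarser_dir hA e1 e2.
exists e3 => e e3e.
have {}h1 := h1 _ (coarser_trans e13 e3e); have {}h2 := h2 _ (coarser_trans e23 e3e).
have qx : Lsub (F (region s)) (lprod (v e) s) by exact: lprod_Lsub.
apply: le_trans (mulL_sqnB (hF (cC k)) (hF (cR s)) (indep_region ks) (hv e k) (hx k) qx px) _.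
move: h2; rewrite le_min => /andP[h21 h22].
have hq : sqn (lprod (v e) s) <= 2 * (1 + sqn p).
  have := sqn_addB hH (lprod (v e) s) p 0; rewrite !subr0 => /le_trans; apply.
  by rewrite ler_pM2l// lerD2r.
exact: (product_error_le (dot_ge0 hH _) (dot_ge0 hH _) (dot_ge0 hH _) p0 x0 r0 h1 hq h22).
Qed.

Lemma capP E s w : cap E s w <-> forall k, k \in s -> E k w.
Proof.
elim: s => [|k s IH]; first by split.
split=> [[Ek /IH h] j|h].
  by rewrite inE => /orP[/eqP ->//|]; exact: h.
split; first by apply: h; rewrite inE eqxx.
by apply/IH => j js; apply: h; rewrite inE js orbT.
Qed.

(** Each side is taken in the trace of [A] on a cell, so its indicator is measurable both for that
    cell and for [A]. *)
Definition cell_boxes A : set_system Omega :=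
  [set cap E (enum (color c)) | E in [set E | forall k, F (A `&` C k) (E k)]].

Lemma cell_boxes_setI A : calA A -> setI_closed (cell_boxes A).
Proof.
move=> cA _ _ [E hE <-] [E' hE' <-]; exists (fun k => E k `&` E' k).
  by move=> k; apply: (setI_F hF) => //; exact: calAI.
apply/seteqP; split=> w.
  by move=> /capP h; split; apply/capP => k /h[].
by move=> [/capP h /capP h']; apply/capP => k ks; split; [exact: h|exact: h'].
Qed.

Lemma F_cell_boxes A : calA A -> F A `<=` generated P (cell_boxes A).
Proof.
move=> cA; have cAC k : calA (A `&` C k) by exact: calAI.
have cAR s : calA (A `&` region s) by exact: calAI.
have -> : A = A `&` region (enum (color c)).
  by apply/seteqP; split=> t; [move=> At; split=> //; rewrite /region /= mem_enum|case].
rewrite [X in cell_boxes X](_ : _ = A); last first.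
  by apply/seteqP; split=> t; [case|move=> At; split=> //; rewrite /region /= mem_enum].
elim: (enum _) (enum_uniq (color c)) => [_|k s IH /= /andP[ks us]].
  rewrite (_ : _ `&` _ = set0); first exact: (F0_generated hA hF hi).
  by apply/seteqP; split=> // t [_]; rewrite /region /=.
have -> : A `&` region (k :: s) = (A `&` C k) `|` (A `&` region s).
  rewrite -setIUr; congr (_ `&` _); apply/seteqP; split=> t; rewrite /region /= inE.
    by case/orP => [/eqP|]; [left|right].
  by case=> [->|->]; rewrite ?eqxx ?orbT.
have [|_ ->] := hi (cAC k) (cAR s).
  by rewrite setIACA region_disj// setI0.
apply: smallest_sub; first exact: smallest_sigma_algebra.
move=> E [[FE|/(IH us)//]|NE]; apply: sub_sigma_algebra; last by right.
left; exists (fun j => if j == k then E else setT).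
  by move=> j; case: eqP => [->//|_]; exact: (setT_F hF (cAC j)).
apply/seteqP; split=> w.
  by move=> /capP /(_ k); rewrite eqxx; apply; rewrite mem_enum.
by move=> Ew; apply/capP => j _; case: eqP.
Qed.

End products_over_cells.

Lemma Lsub_event B (c : coloring) (Pr : pred {set color c}) x :
  calA B -> Lsub (F B) x -> Lsub (F B) (event Q Pr x).
Proof.
move=> cB xB; have [sB _ _] := hF cB; apply: Lsub_sum => // J.
apply: Lsub_sum => // I; rewrite -[_ *: _]addr0; apply: Lsub_lin => //; last exact: Lsub0.
apply: (Lsub_QI hA hF hi) => //; exact: cell_meas.
Qed.

Lemma event_compl (c : coloring) (Pr : pred {set color c}) x : Q setT x = x ->
  x - event Q Pr x = event Q (fun J => ~~ Pr J) x.
Proof.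
move=> Qx; have e : x = event Q Pr x + event Q (fun J => ~~ Pr J) x.
  by rewrite -{1}(eventT Qx c) {1}/event (bigID Pr).
by rewrite {1}e addrC addKr.
Qed.

(* [g], the limit of the projections of [f] to spectral sets visiting each cell of
   [c] at most once, has squared distance at most [4 r] from [f] and is orthogonal to
   all products of indicators over the cells of [c], hence zero. *)
Lemma linear_orth_eq0 A f : calA A -> Lsub (F A) f ->
  (forall s, Lsub (linear_field A) s -> dot f s = 0) -> f = 0.
Proof.
move=> cA fA fG; have cT := calAT hA; have QAf := (Lsub_FE hF _ cA).1 fA.
have subT B x : calA B -> Lsub (F B) x -> Q setT x = x.
  by move=> cB xB; apply/(Lsub_FE hF _ cT); apply: Lsub_mono xB; exact: (F_mono hA hi).
have QTf : Q setT f = f by exact: subT fA.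
have hG := linear_sub_sigma_field cA; have [sG _ _] := hG.
suff h r : 0 < r -> sqn f <= 4 * r.
  apply: (dot_eq0 hH); apply/eqP; rewrite eq_le (dot_ge0 hH) andbT leNgt.
  (* With [r = sqn f / 8] the claim would give [sqn f <= sqn f / 2]. *)
  apply/negP => f0; have := h _ (divr_gt0 f0 (ltr0Sn R 7)); rewrite leNgt => /negP; apply.
  by move: f0; move: (sqn f) => a a0; lra.
move=> r0; have [c hc] := stable_coloring hH hA hQ QTf r0.
have [g hg] := decreasing_net_cvg (x := fun e => injective_event hA Q c e f) hH
  (trivial_coloring hA) (coarser_dir hA)
  (fun e e' ee' => injective_event_net hH hA hQ c f ee').
have gA : Lsub (F A) g.
  apply/(Lsub_FE hF _ cA); apply: (dot_ext hH) => z.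
  rewrite (Qsym hQ)//; apply/eqP; rewrite -subr_eq0 -(dotBr hH); apply/eqP.
  apply: (dot_closed hH) => e' /hg[e he]; exists (injective_event hA Q c e f).
    exact: he (coarser_refl e).
  rewrite (dotBr hH) -(Qsym hQ)// ((Lsub_FE hF _ cA).1 _) ?subrr//.
  exact: Lsub_event.
suff g0 : g = 0.
  have [e he] := hg _ r0; have {he} := he e (coarser_refl e).
  have h1 : sqn (f - injective_event hA Q c e f) <= r.
    rewrite /injective_event event_compl//.
    apply: le_trans (hc (pair_coloring hA c e) fst (fun=> erefl)).
    rewrite le_eqVlt; apply/orP; left; apply/eqP; congr (dot _ _);
      by apply: eq_bigl => L; rewrite ltn_neqAle leq_imset_card andbT.
  have := sqn_addB hH f (injective_event hA Q c e f) g; rewrite g0 !subr0.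
  move=> /le_trans h2 h3; apply: h2.
  by move: h1 h3; move: (sqn (f - _)) (sqn (injective_event _ _ _ _ _)) => a b; lra.
have cC k := @coloring_meas _ _ c k.
have cAC k : calA (A `&` c @^-1` [set k]) by exact: calAI.
have boxM : cell_boxes c A `<=` measurable.
  by move=> _ [E hE <-]; apply: cap_meas => k; exact: (F_meas hF (cAC k)).
apply: (Lsub_eq0 boxM (cell_boxes_setI cA)).
- exists (fun=> setT); first by move=> k; exact: (setT_F hF (cAC k)).
  by apply/seteqP; split=> // w _; apply/capP.
- by apply: Lsub_mono gA; exact: F_cell_boxes.
move=> _ [E hE <-].
have mE k : measurable (E k) by exact: (F_meas hF (cAC k)).
have indAC k : Lsub (F (A `&` c @^-1` [set k])) (ind (E k)) by exact: (Lsub_ind (hF (cAC k))).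
have indC k : Lsub (F (c @^-1` [set k])) (ind (E k)).
  by apply: Lsub_mono (indAC k); apply: (F_mono hA hi) => //; exact: subIsetr.
have indA k : Lsub (F A) (ind (E k)).
  by apply: Lsub_mono (indAC k); apply: (F_mono hA hi) => //; exact: subIsetl.
have /choice[psi hpsi] := fun k => first_chaos hH hA hQ (ind (E k)).
(* The limit of the thinned indicators on cell [k]: expectation plus first chaos. *)
pose x k := Q set0 (ind (E k)) + psi k.
have c0 := calA0 hA.
have xC k : Lsub (F (c @^-1` [set k])) (x k).
  have [sC _ _] := hF (cC k); apply: LsubD => //.
    by apply: Lsub_mono (Lsub_Q hF _ c0); exact: (F_mono hA hi).
  have [_ _ h] := hpsi k; apply/(Lsub_FE hF _ (cC k)); apply: h => //.
  exact/(Lsub_FE hF _ (cC k)).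
(* The indicator of [E k] is [F A]-measurable, so [Q A] fixes [psi k]; the constant part is
   measurable for [F set0]. *)
have xG k : Lsub (linear_field A) (x k).
  apply: LsubD => //.
    by apply: Lsub_mono (Lsub_Q hF _ c0); exact: F0_linear.
  have [_ h1 h2] := hpsi k; apply: chaos_linear => //; apply: h2 => //.
  exact/(Lsub_FE hF _ cA).
pose s := enum (color c); have us : uniq s by exact: enum_uniq.
pose v (e : coloring) k := thinQ (c @^-1` [set k]) e (ind (E k)).
have vC e k : Lsub (F (c @^-1` [set k])) (v e k) by exact: (Lsub_thin hA hF hi).
have vx k (q : R) : 0 < q -> exists e0, forall e, coarser e0 e -> sqn (v e k - x k) <= q.
  have [h _ _] := hpsi k => /h[e0 he0]; exists e0 => e /he0.
  by rewrite /v /x (thin_chaos hA hF hi)// opprD addrACA subrr add0r.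
set U := ind _; have UE : U = lprod (fun k => ind (E k)) s by rewrite lprod_ind.
have UT : Q setT U = U.
  by rewrite UE; apply: (subT _ _ (calA_region s)); exact: lprod_Lsub.
have fV : dot f (lprod x s) = 0 by apply: fG; exact: lprod_Lsub_gen.
apply: (@ler_sqr_small _ _ (2 * (sqn U + sqn f))).
  by rewrite mulr_ge0// addr_ge0// (dot_ge0 hH).
move=> q q0; have [e1 h1] := hg _ q0; have [e2 h2] := lprod_cvg us vC xC vx q0.
have [e [e1e e2e]] := coarser_dir hA e1 e2.
have {}h1 := h1 _ e1e; have {}h2 := h2 _ e2e.
(* Symmetry moves the projection onto [U], where it acts factorwise; subtracting the limit product
   is free, as [f] is orthogonal to it. *)
have RU : dot (injective_event hA Q c e f) U = dot f (lprod (v e) s - lprod x s).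
  rewrite (event_sym hH hA hQ) -/(injective_event hA Q c e U) (injective_thin hH hA hQ _ _ UT).
  by rewrite -/(thins e s U) UE thins_lprod// (dotBr hH) fV subr0.
have gE : dot g U = dot (g - injective_event hA Q c e f) U + dot f (lprod (v e) s - lprod x s).
  by rewrite (dotBl hH) RU subrK.
have k1 := dot_CS hH (g - injective_event hA Q c e f) U.
have k2 := dot_CS hH f (lprod (v e) s - lprod x s).
rewrite gE; rewrite (sqnBC hH) in k1.
have U0 := dot_ge0 hH U; have f0 := dot_ge0 hH f.
have {}k1 := le_trans k1 (ler_wpM2r U0 h1); have {}k2 := le_trans k2 (ler_wpM2l f0 h2).
move: k1 k2; move: (dot (g - _) U) (dot f (_ - _)) (sqn U) (sqn f) => a b u w k1 k2.
have := sqr_ge0 (a - b); nra.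
Qed.

End linearization.

(** * From L2 back to events *)

Lemma standard_borel_sigma_algebra (R : realType) (T : Type) (calA : set_system T) :
  standard_borel R calA -> sigma_algebra setT calA.
Proof.
move=> [M [f [_ _ ->]]]; apply: sigma_algebra_preimage.
exact: smallest_sigma_algebra.
Qed.

(** A [G]-measurable version [f] of the indicator recovers [E] as the event [f = 1] up to a null
    set, and [G] contains the null sets. *)
Lemma Lsub_ind_mem (d : measure_display) (Omega : measurableType d) (R : realType)
    (P : probability Omega R) (G : set_system Omega) (E : set Omega) :
  sub_sigma_field P G -> measurable E -> @Lsub _ _ _ P G (ind P E) -> G E.
Proof.
move=> [sG GM NG] mE [f [f2 fG] Ef].
have [N [mN N0 hN]] := cls_inj_ae (ind_sqint P mE) f2 Ef.
have [_ GD GU GI] := (sigma_algebraP (fun _ _ => @subsetT _ _)).1 sG.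
have nullG B : measurable B -> B `<=` N -> G B.
  by move=> mB BN; apply: NG; split=> //; exact: (subset_measure0 _ _ BN).
have [_ GC Gcup] := sG.
have -> : E = ((f @^-1` [set 1]) `&` ~` N) `|` (E `&` N).
  have fE w : ~ N w -> f w = \1_E w.
    by move=> Nw; apply: contrapT => h; apply: Nw; apply: hN => /= h'; apply: h.
  apply/seteqP; split=> w.
    move=> Ew; have [Nw|Nw] := pselect (N w); first by right.
    by left; split=> //=; rewrite fE// indicE mem_set.
  case=> [[/= fw /fE]|[]//]; rewrite fw indicE; case: (boolP (w \in E)) => [/set_mem//|_].
  by move/eqP; rewrite oner_eq0.
rewrite -bigcup2E; apply: Gcup => -[|[|n]] /=.
- apply: GI; first exact: fG.
  by rewrite -setTD; apply: GC; exact: nullG.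
- by apply: nullG; [exact: measurableI|exact: subIsetr].
- by have [] := sG.
Qed.

Definition trivial_events (d : measure_display) (Omega : measurableType d)
    (R : realType) (P : probability Omega R) : set_system Omega :=
  [set E | null_sets P E \/ null_sets P (~` E)].

Lemma trivial_events_sigma_algebra (d : measure_display) (Omega : measurableType d)
    (R : realType) (P : probability Omega R) : sigma_algebra setT (trivial_events P).
Proof.
split.
- by left; split; [exact: measurable0|exact: measure0].
- by move=> E h; rewrite setTD /trivial_events /= setCK or_comm.
move=> E hE; have mE n : measurable (E n).
  by have [[]//|[m _]] := hE n; rewrite -[E n]setCK; exact: measurableC.
have mU : measurable (\bigcup_n E n) by exact: bigcupT_measurable.
have [[n nE]|allN] := pselect (exists n, null_sets P (~` E n)).
  right; case: nE => mn n0; split; first exact: measurableC.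
  apply: (subset_measure0 _ _ _ n0) => //; first exact: measurableC.
  by apply: subsetC; exact: bigcup_sup.
left; split=> //; apply/eqP; rewrite eq_le measure_ge0 andbT.
apply: le_trans (measure_sigma_subadditive _ mE mU (@subset_refl _ _)) _.
rewrite eseries0// => n _ _; have [[]//|h] := hE n.
by case: allN; exists n.
Qed.

Theorem mainTheorem1 (R : realType)
    (d : measure_display) (Omega : measurableType d) (P : probability Omega R)
    (T : Type) (calA : set_system T) (F : set T -> set_system Omega)
    (hT : standard_borel R calA)
    (hF : forall A : set T, calA A -> sub_sigma_field P (F A))
    (hi : forall A B : set T, calA A -> calA B -> A `&` B = set0 ->
      independent P (F A) (F B) /\
      F (A `|` B) = generated P (F A `|` F B))
    (hii : forall A_ : nat -> set T, (forall n, calA (A_ n)) ->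
      (forall n, A_ n `<=` A_ n.+1) ->
      F (\bigcup_n A_ n) = generated P (\bigcup_n F (A_ n))) :
  linearizable P calA F /\
  (nondegenerate_field P (F [set: T]) ->
   exists X : set T -> {RV P >-> R},
     decomposable_process calA F X /\ nontrivial_process calA X).
Proof.
have hA := standard_borel_sigma_algebra hT.
have lin : linearizable P calA F.
  move=> A cA; have hG := linear_sub_sigma_field hF cA; have [sG _ _] := hG.
  apply/seteqP; split; last exact: (linear_field_sub hF cA).
  move=> E FE; have mE := F_meas hF cA FE; apply: (Lsub_ind_mem hG mE).
  (* The residual is [F A]-measurable and orthogonal to the linear field, so [linear_orth_eq0] kills
     it. *)
  suff e : ind P E - condE (linear_field P calA F A) (ind P E) = 0.
    move/eqP: e; rewrite subr_eq0 => /eqP ->; exact: condE_Lsub.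
  apply: (linear_orth_eq0 hA hF hi hii cA) => [|s sL].
    have [sF _ _] := hF _ cA; apply: LsubB => //; first exact: (Lsub_ind (hF _ cA)).
    by apply: Lsub_mono (condE_Lsub hG _); exact: (linear_field_sub hF cA).
  by rewrite (dotBl (L2_hilbert P)) (condE_dot hG)// subrr.
split=> // -[E FE]; case/andP=> E0 E1; apply: contrapT => /forallNP noX.
have cT := calAT hA.
(* If every [X setT] is almost surely constant, it generates only events that are null or have null
   complement; by linearizability the same holds for [F setT]. *)
have : trivial_events P E.
  have := FE; rewrite (lin _ cT); move: E {FE E0 E1}.
  apply: smallest_sub; first exact: trivial_events_sigma_algebra.
  move=> E [[X dX [B mB XB]]|NE]; last by left.
  have Xtriv : forall A, calA A -> exists c : R, {ae P, forall w, X A w = c}.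
    by apply: contrapT => nX; exact: (noX X).
  have [c [N [mN N0 hN]]] := Xtriv _ cT.
  have mX : measurable (X setT @^-1` B).
    by rewrite -[X in measurable X]setTI; exact: measurable_funP.
  rewrite -XB setTI; have XN w : ~ N w -> X setT w = c.
    by move=> Nw; apply: contrapT => h; apply: Nw; exact: hN.
  have [Bc|Bc] := pselect (B c).
    right; split; first exact: measurableC.
    apply: (subset_measure0 _ _ _ N0) => //; first exact: measurableC.
    by move=> w /= nB; apply: contrapT => /XN Xc; apply: nB; rewrite Xc.
  left; split=> //; apply: (subset_measure0 _ _ _ N0) => //.
  by move=> w /= BX; apply: contrapT => /XN Xc; apply: Bc; rewrite -Xc.
case=> -[mE e0]; first by rewrite e0 ltxx in E0.
by move: E1; rewrite -[E]setCK probability_setC// e0 sube0 ltxx.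
Qed.
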